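(* Let $a=(a(n))_{n\ge1}$ and $b=(b(n))_{n\ge1}$ be real sequences such that, for some constants $0<c<C<\infty$, $a(n)\in[c,C]$ and $b(n)\in[-C,C]$ for all $n\ge 1$, and let $J(a,b)$ be the associated Jacobi matrix acting on $\ell^2(\mathbb{N})$. Let $-\infty\le E_L<E_R\le+\infty$. Put $M=\sup_{j\ge1}a(j)$ and, for $n\ge1$, \[ A_n=\big[a(1)a(2)\cdots a(n)\big]^{1/n}, \] \[ I_n=\big\{1\le j\le n \;:\; b(j)\in(E_L-2M-A_n,\;E_R+2M+A_n)\big\}, \] \[ D_n=\prod_{1\le j\le n,\; j\notin I_n}\Big(\min\big(|b(j)-E_R|,|b(j)-E_L|\big)-2M\Big). \] Then \[ \big|\Sigma_{\mathrm{ac}}(J(a,b))\cap(E_L,E_R)\big|\;\le\;4\,\liminf_{n\to\infty}\left[\frac{A_n^n}{D_n}\right]^{1/\#I_n}. \]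
   Context: The Jacobi matrix $J=J(a,b)$ is the bounded self-adjoint operator on $\ell^2(\mathbb{N})$, $\mathbb{N}=\{1,2,\dots\}$, given by $(J\psi)(n)=a(n-1)\psi(n-1)+a(n)\psi(n+1)+b(n)\psi(n)$ for $n\ge1$, with the formal conventions $a(0)=1$, $\psi(0)=0$. The essential support of the absolutely continuous spectrum is the set (considered modulo sets of Lebesgue measure zero) \[\Sigma_{\mathrm{ac}}(J)=\big\{E\in\mathbb{R} : \lim_{\epsilon\downarrow0}\operatorname{Im}\,(J-E-i\epsilon)^{-1}(1,1)\text{ exists and differs from }0\big\},\] where $(\cdot)(1,1)$ denotes the $(1,1)$ matrix element $\langle\delta_1,\cdot\,\delta_1\rangle$. $|\cdot|$ of a set is Lebesgue measure, $\#$ is cardinality. Conventions: an empty product equals $1$; if $E_R=+\infty$ (resp. $E_L=-\infty$) then $|b(j)-E_R|=+\infty$ (resp. $|b(j)-E_L|=+\infty$); if $\#I_n=0$, the $n$-th term $[A_n^n/D_n]^{1/\#I_n}$ is interpreted as $0$. *)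

(* Defs.v *)
From HB Require Import structures.
From mathcomp Require Import all_boot all_order all_algebra finmap.
From mathcomp Require Import complex.
From mathcomp Require Import all_classical all_reals all_analysis.

Set Implicit Arguments.
Unset Strict Implicit.
Unset Printing Implicit Defensive.

Import Order.TTheory GRing.Theory Num.Theory.
Import numFieldNormedType.Exports.

Local Open Scope classical_set_scope.
Local Open Scope ring_scope.

(** Sequences indexed by {1, 2, ...} are functions on [nat]. For vectors the
    value at 0 is required to be 0 (see [l2]); the values [a 0] and [b 0] of
    coefficient sequences are never used. *)

Section Jacobi.
Context {R : realType}.
Implicit Types (a b : nat -> R) (z : R[i]) (phi psi : nat -> R[i]).

Definition l2 : set (nat -> R[i]) :=
  [set psi | psi 0%N = 0 /\
    cvgn (series (fun n => complex.ComplexField.Normc.normc (psi n) ^+ 2))].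

(** Conjugate-linear in the first argument. The real and imaginary parts of the
    series are summed separately; both converge absolutely on [l2]. *)
Definition l2_inner phi psi : R[i] :=
  let w n := conjc (phi n) * psi n in
  Complex (limn (series (fun n => complex.Re (w n))))
          (limn (series (fun n => complex.Im (w n)))).

Definition delta1 : nat -> R[i] := fun n => (n == 1%N)%:R.

Definition jacobi a b psi : nat -> R[i] := fun n =>
  if n is m.+1 then
    real_complex R (if m is 0 then 1 else a m) * psi m
    + real_complex R (a n) * psi n.+1 + real_complex R (b n) * psi n
  else 0.

(** [(J - z)^-1]: the preimage of [phi] under [J - z] in [l2]. The default value
    [0] is irrelevant for [z] off the spectrum, where [J - z] is a bijection of
    [l2], in particular for all non-real [z]. *)
Definition resolvent a b z phi : nat -> R[i] :=
  xget (fun=> 0)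
    [set psi | l2 psi /\ (fun n => jacobi a b psi n - z * psi n) = phi].

Definition green11 a b z : R[i] := l2_inner delta1 (resolvent a b z delta1).

Definition Sigma_ac a b : set R :=
  [set E | exists2 l : R, l != 0 &
    complex.Im (green11 a b (Complex E e)) @[e --> 0^'+] --> l].

End Jacobi.

Section Bound.
Context {R : realType}.
Implicit Types (a b : nat -> R) (EL ER : \bar R).

Definition supa a : R := sup [set a j | j in [set j | (1 <= j)%N]].

Definition geom_mean a (n : nat) : R :=
  (\prod_(1 <= j < n.+1) a j) `^ (n%:R^-1).

Definition I_ a b EL ER (n : nat) : {fset nat} :=
  [fset j in index_iota 1 n.+1 |
    (EL - (2 * supa a)%:E - (geom_mean a n)%:E < (b j)%:E
      < ER + (2 * supa a)%:E + (geom_mean a n)%:E)%E]%fset.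

(** [fine] loses nothing: if [EL] or [ER] is finite then so is the minimum, and
    if both are infinite then every [j] is in [I_n] and the product is empty. *)
Definition D_ a b EL ER (n : nat) : R :=
  \prod_(1 <= j < n.+1 | j \notin I_ a b EL ER n)
    (fine (Order.min `|(b j)%:E - ER| `|(b j)%:E - EL|)%E - 2 * supa a).

Definition bound_term a b EL ER (n : nat) : R :=
  let k := #|` I_ a b EL ER n| in
  if k == 0%N then 0
  else (geom_mean a n ^+ n / D_ a b EL ER n) `^ (k%:R^-1).

End Bound.

(* Main.v *)
Require Import Defs.
From HB Require Import structures.
From mathcomp Require Import all_boot all_order all_algebra finmap.
From mathcomp Require Import complex.
From mathcomp Require Import all_classical all_reals all_analysis measurable_realfun.
From mathcomp Require Import ring lra.

(** Let [p_i] be the orthonormal polynomials of [J], so that the monic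
    characteristic polynomial of the truncation [J_n] is
    [P_n = a_1 ... a_n p_(n+1)].

    Upper bound for [P_n] on the a.c. spectrum: the spectral measures of the
    truncations are Gauss quadratures with [sum_j w_j p_n(l_j)^2 = 1], hence the
    Poisson integrals of [p_n^2] against them have total mass at most [pi].  Since
    the Poisson integrals of the measures themselves converge to [Im G(E + i e)],
    which stays above [1/k] on a set [X_k] exhausting [Sigma_ac], the part of
    [X_k] on which [|p_(n+1)| > K] has measure [O(k / K^2)], uniformly in [n].

    Lower bound for [P_n]: by Weyl's inequalities the eigenvalues of [J_n] can be
    paired with the [b_j] at distance at most [2 M].  For [E] in the window, the
    eigenvalues paired with [j] outside [I_n] contribute at least [D_n] to
    [|P_n(E)|]; the other ones form a monic polynomial [Q] of degree [#I_n].

    On the remaining part of [X_k] we thus have [|Q| <= K A_n^n / D_n], and Polya's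
    inequality [|{|Q| <= eta}| <= 4 (eta / 2)^(1 / deg Q)] applies.  To absorb [K]
    even when [#I_n] stays bounded, the window is shrunk by [d] on both sides, which
    improves every factor of [D_n] by a fixed factor [1 + kap]. *)

Set Implicit Arguments.
Unset Strict Implicit.
Unset Printing Implicit Defensive.

Import Order.TTheory GRing.Theory Num.Theory.
Import numFieldNormedType.Exports.
Local Open Scope ring_scope.

(** * Orthogonal polynomials and Gauss quadrature *)

(** The equation [J u = x u] at the sites from 1 on. The ring is arbitrary because [x] will be a
    real number, a complex number and the polynomial ['X]. *)
Definition three_term (A : comNzRingType) (al be : nat -> A) (x : A) (u : nat -> A) :=
  forall n, (1 <= n)%N ->
    al n * u n.+1 = (x - be n) * u n - al n.-1 * u n.-1.

(** Summation by parts: only the boundary term at [n] survives. As [v] is arbitrary, this also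
    serves for test vectors and for solutions of the resolvent equation. *)
Lemma green_identity (A : comNzRingType) (al be u v : nat -> A) (x : A) n :
  u 0%N = 0 -> v 0%N = 0 -> three_term al be x u ->
  \sum_(1 <= i < n.+1) u i * (al i.-1 * v i.-1 + al i * v i.+1 + be i * v i) =
  x * (\sum_(1 <= i < n.+1) u i * v i) + al n * (u n * v n.+1 - u n.+1 * v n).
Proof.
move=> u0 v0 hu; elim: n => [|n IHn].
  by rewrite u0 v0 !big_geq// !(mulr0, mul0r) subr0 mulr0 addr0.
rewrite big_nat_recr//= IHn [in RHS]big_nat_recr//=.
have /= hun := hu n.+1 isT.
rewrite [in RHS]mulrBr [al n.+1 * (u n.+2 * _)]mulrA hun; by ring.
Qed.

Lemma christoffel_darboux (A : comNzRingType) (al be u v : nat -> A) (x y : A) n :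
  u 0%N = 0 -> v 0%N = 0 -> three_term al be x u -> three_term al be y v ->
  al n * (u n.+1 * v n - u n * v n.+1) =
  (x - y) * \sum_(1 <= i < n.+1) u i * v i.
Proof.
move=> u0 v0 hu hv; have := green_identity n u0 v0 hu.
have -> : \sum_(1 <= i < n.+1) u i * (al i.-1 * v i.-1 + al i * v i.+1 + be i * v i) =
    y * \sum_(1 <= i < n.+1) u i * v i.
  rewrite mulr_sumr !big_nat; apply: eq_bigr => i /andP[i1 _].
  by rewrite hv//; ring.
by move=> h; rewrite mulrBl h; ring.
Qed.

Section OrthogonalPolynomials.
Context {R : rcfType} (a b : nat -> R).
Hypothesis a_neq0 : forall n, (1 <= n)%N -> a n != 0.

(* As in the paper sites are numbered from 1, so [opoly n] has degree [n - 1]. *)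
Fixpoint opoly_pair (n : nat) : {poly R} * {poly R} :=
  if n is m.+1 then
    let: (q, p) := opoly_pair m in
    (p, (a n)^-1 *: (('X - (b n)%:P) * p - a m *: q))
  else (0, 1).

Definition opoly n := (opoly_pair n).1.

Lemma opoly0 : opoly 0 = 0. Proof. by []. Qed.
Lemma opoly1 : opoly 1 = 1. Proof. by []. Qed.

Lemma opolySS n :
  opoly n.+2 = (a n.+1)^-1 *: (('X - (b n.+1)%:P) * opoly n.+1 - a n *: opoly n).
Proof. by rewrite /opoly /=; case: (opoly_pair n). Qed.

Lemma opoly_size_lead n :
  size (opoly n.+1) = n.+1 /\
  lead_coef (opoly n.+1) = \prod_(1 <= j < n.+1) (a j)^-1.
Proof.
suff : [/\ (size (opoly n) <= n)%N, size (opoly n.+1) = n.+1 &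
  lead_coef (opoly n.+1) = \prod_(1 <= j < n.+1) (a j)^-1] by case.
elim: n => [|n [IH1 IH2 IH3]].
  by rewrite opoly0 opoly1 size_poly0 size_poly1 lead_coef1 big_geq.
have hp : opoly n.+1 != 0 by rewrite -size_poly_eq0 IH2.
have ai : (a n.+1)^-1 != 0 by rewrite invr_eq0 a_neq0.
have sX : size (('X - (b n.+1)%:P) * opoly n.+1) = n.+2.
  by rewrite size_proper_mul ?size_XsubC ?IH2// lead_coefXsubC mul1r lead_coef_eq0.
have sl : (size (- (a n *: opoly n)) < size (('X - (b n.+1)%:P) * opoly n.+1)%R)%N.
  by rewrite sX size_polyN (leq_ltn_trans (size_scale_leq _ _))// ltnW.
split; first by rewrite IH2.
  by rewrite opolySS size_scale// size_polyDl.
rewrite opolySS lead_coefZ lead_coefDl// lead_coefM lead_coefXsubC mul1r IH3.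
by rewrite [RHS]big_nat_recr//= mulrC.
Qed.

Lemma size_opoly n : size (opoly n.+1) = n.+1.
Proof. by case: (opoly_size_lead n). Qed.

Lemma lead_coef_opoly n :
  lead_coef (opoly n.+1) = \prod_(1 <= j < n.+1) (a j)^-1.
Proof. by case: (opoly_size_lead n). Qed.

Lemma opoly_three_term (A : comNzRingType) (f : {rmorphism R -> A}) (x : A) :
  three_term (f \o a) (f \o b) x (fun n => (map_poly f (opoly n)).[x]).
Proof.
move=> [//|n] _ /=; rewrite opolySS.
rewrite map_polyZ hornerZ mulrA -rmorphM mulfV ?a_neq0// rmorph1 mul1r.
rewrite rmorphB rmorphM /= map_polyZ rmorphB /= map_polyX map_polyC.
by rewrite hornerD hornerN hornerM hornerZ hornerD hornerN hornerX hornerC.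
Qed.

Lemma opoly_CD (A : comNzRingType) (f : {rmorphism R -> A}) (x y : A) n :
  f (a n) * ((map_poly f (opoly n.+1)).[x] * (map_poly f (opoly n)).[y]
     - (map_poly f (opoly n)).[x] * (map_poly f (opoly n.+1)).[y]) =
  (x - y) * \sum_(1 <= i < n.+1) (map_poly f (opoly i)).[x] * (map_poly f (opoly i)).[y].
Proof.
apply: (@christoffel_darboux _ (f \o a) (f \o b) (fun n => (map_poly f (opoly n)).[x])
  (fun n => (map_poly f (opoly n)).[y])).
- by rewrite rmorph0 horner0.
- by rewrite rmorph0 horner0.
- exact: opoly_three_term.
- exact: opoly_three_term.
Qed.

Lemma opoly_CD_real (x y : R) n :
  a n * ((opoly n.+1).[x] * (opoly n).[y] - (opoly n).[x] * (opoly n.+1).[y]) =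
  (x - y) * \sum_(1 <= i < n.+1) (opoly i).[x] * (opoly i).[y].
Proof.
have := opoly_CD idfun x y n; rewrite !map_poly_id//= => ->.
by under eq_bigr do rewrite map_poly_id//.
Qed.

Lemma sum_opoly_sqr_gt0 (x : R) n : (1 <= n)%N ->
  0 < \sum_(1 <= i < n.+1) (opoly i).[x] ^+ 2.
Proof.
move=> n1; rewrite big_ltn ?ltnS// opoly1 hornerC expr1n.
by rewrite ltr_pwDl// sumr_ge0// => i _; rewrite sqr_ge0.
Qed.

(* Christoffel-Darboux at [(z, conj z)] makes [(z - conj z) * \sum |p_i(z)|^2]
   vanish. *)
Lemma opoly_root_real n (z : R[i]) : (1 <= n)%N ->
  root (map_poly (real_complex R) (opoly n.+1)) z -> exists x : R, z = x%:C%C.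
Proof.
move=> n1 /eqP rz; pose f := real_complex R.
have conjH p : (map_poly f p).[conjc z] = conjc (map_poly f p).[z].
  rewrite -horner_map -map_poly_comp; congr (_.[_]).
  by apply: eq_map_poly => x; exact/esym/conjc_real.
have := opoly_CD f z (conjc z) n.
rewrite !conjH rz rmorph0 mul0r mulr0 subrr mulr0 => /esym/eqP; rewrite mulf_eq0 => /orP[|].
  case: z {rz conjH} => x y; rewrite subr_eq0 => /eqP[] yNy.
  by exists x; congr Complex; lra.
under eq_bigr do rewrite conjH.
move=> /eqP /(congr1 (@complex.Re R)); rewrite raddf_sum/= => s0; exfalso.
have : 0 < \sum_(1 <= i < n.+1) complex.Re ((map_poly f (opoly i)).[z] *
    conjc (map_poly f (opoly i)).[z]).
  rewrite big_ltn// opoly1 rmorph1 hornerC; apply: ltr_pwDl.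
    by rewrite /= !(mulr0, mul0r, mulr1, oppr0, subr0) ltr01.
  apply: sumr_ge0 => i _; case: (_.[z]) => u v /=.
  by rewrite mulrN opprK addr_ge0// -expr2 sqr_ge0.
by rewrite s0 ltxx.
Qed.

(* Christoffel-Darboux at [('X, x)], divided by ['X - x], is evaluated at [x]. *)
Lemma opoly_root_simple n (x : R) : (1 <= n)%N ->
  ~~ (('X - x%:P) ^+ 2 %| opoly n.+1).
Proof.
move=> n1; apply/negP => /dvdpP[q hq].
have rx : (opoly n.+1).[x] = 0.
  by rewrite hq expr2 !hornerM hornerXsubC subrr mul0r mulr0.
have hu : three_term (fun i => (a i)%:P) (fun i => (b i)%:P) 'X opoly.
  move=> [//|i] _.
  by rewrite /= opolySS -mul_polyC mulrA -polyCM mulfV ?a_neq0// mul1r mul_polyC.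
have hv : three_term (fun i => (a i)%:P) (fun i => (b i)%:P) x%:P
    (fun i => (opoly i).[x]%:P).
  move=> [//|i] _; have := opoly_three_term idfun x (isT : (1 <= i.+1)%N).
  by rewrite /= !map_poly_id// -!polyCM => ->; rewrite polyCB !polyCM polyCB.
have := christoffel_darboux n opoly0 _ hu hv.
rewrite opoly0 horner0 polyC0 rx polyC0 mulr0 subr0 => /(_ erefl).
rewrite hq; set c := (_.[x])%:P; set S := \sum_(_ <= _ < _) _ => hS.
have : ('X - x%:P) * ((a n)%:P * q * ('X - x%:P) * c) = ('X - x%:P) * S.
  by rewrite -hS; ring.
move=> /(mulfI (negbT (polyXsubC_eq0 x))) /(congr1 (horner^~ x)); rewrite /S.
rewrite !(hornerM, hornerXsubC) subrr mulr0 !mul0r.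
rewrite horner_sum; under eq_bigr do rewrite hornerM hornerC -expr2.
by move=> /eqP; rewrite lt_eqF// sum_opoly_sqr_gt0.
Qed.

(** Factor over the closed field [R[i]]: the roots are real by [opoly_root_real], so the
    factorization descends to [R], and a repeated root would give a square factor, excluded by
    [opoly_root_simple]. *)
Lemma opoly_roots n : (1 <= n)%N ->
  exists2 l : 'I_n -> R, injective l &
    opoly n.+1 = (\prod_(1 <= j < n.+1) (a j)^-1) *: \prod_(i < n) ('X - (l i)%:P).
Proof.
move=> n1; pose f := real_complex R.
have [r] := closed_field_poly_normal (map_poly f (opoly n.+1)).
rewrite lead_coef_map lead_coef_opoly => hr.
set k := \prod_(1 <= j < n.+1) _ in hr *.
have k0 : k != 0.
  by rewrite /k -lead_coef_opoly lead_coef_eq0 -size_poly_eq0 size_opoly.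
have fk0 : f k != 0 by rewrite fmorph_eq0.
have sr : size r = n.
  apply/eq_add_S; rewrite -(size_prod_XsubC r id) -size_opoly -(size_map_poly f) hr.
  by rewrite size_scale.
have rreal z : z \in r -> z = (complex.Re z)%:C%C.
  move=> zr; have [|x ->//] := @opoly_root_real n z n1.
  by rewrite -/f hr rootZ// root_prod_XsubC.
pose s := map (@complex.Re R) r.
have hs : opoly n.+1 = k *: \prod_(x <- s) ('X - x%:P).
  apply: (map_poly_inj f); rewrite hr map_polyZ; congr (_ *: _).
  rewrite rmorph_prod big_map big_seq [RHS]big_seq; apply: eq_bigr => z zr /=.
  by rewrite rmorphB /= map_polyX map_polyC /= -rreal.
have ss : size s = n by rewrite size_map.
have us : uniq s.
  apply/negPn/negP => /(uniqPn 0)[i [j [ij js sij]]].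
  have /negP := @opoly_root_simple n s`_i n1; apply; rewrite hs dvdpZr//.
  have -> : \prod_(x <- s) ('X - x%:P) =
      \prod_(x <- take j s) ('X - x%:P) * \prod_(x <- drop j s) ('X - x%:P).
    by rewrite -big_cat cat_take_drop.
  rewrite expr2 dvdp_mul//.
    rewrite dvdp_XsubCl root_prod_XsubC.
    have -> : s`_i = (take j s)`_i by rewrite nth_take.
    by rewrite mem_nth// size_take js.
  by rewrite (drop_nth 0 js) big_cons sij dvdp_mulr.
exists (fun i => s`_i).
  move=> i j /eqP; rewrite nth_uniq ?ss// => /eqP; exact: val_inj.
by rewrite hs (big_nth 0) ss big_mkord.
Qed.

(** At a zero of [opoly n.+1] this is the weight of Gauss quadrature: the squared first entry of the
    normalized eigenvector of the truncation. *)
Definition christoffel n (x : R) : R := (\sum_(1 <= i < n.+1) (opoly i).[x] ^+ 2)^-1.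

Lemma christoffel_gt0 n x : (1 <= n)%N -> 0 < christoffel n x.
Proof. by move=> n1; rewrite invr_gt0 sum_opoly_sqr_gt0. Qed.

Section Quadrature.
Variables (n : nat) (l : 'I_n -> R).
Hypothesis n1 : (1 <= n)%N.
Hypothesis l_inj : injective l.
Hypothesis l_root : forall i, (opoly n.+1).[l i] = 0.

(** At two distinct zeros of [opoly n.+1] the left-hand side of Christoffel-Darboux vanishes. *)
Lemma opoly_row_orthonormal (j k : 'I_n) :
  \sum_(1 <= i < n.+1) (opoly i).[l j] * (opoly i).[l k] =
  (j == k)%:R / christoffel n (l j).
Proof.
have [<-|jk] := eqVneq j k.
  by rewrite mul1r invrK; apply: eq_bigr => i _; rewrite expr2.
rewrite mul0r; have := opoly_CD_real (l j) (l k) n.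
rewrite !l_root mul0r mulr0 subrr mulr0 => /esym/eqP.
by rewrite mulf_eq0 subr_eq0 inj_eq// (negPf jk) => /eqP.
Qed.

(* The matrix [sqrt (w_j) p_i (l_j)] is orthogonal by rows, hence by columns. *)
Lemma opoly_col_orthonormal (i k : nat) :
  (1 <= i <= n)%N -> (1 <= k <= n)%N ->
  \sum_j christoffel n (l j) * ((opoly i).[l j] * (opoly k).[l j]) = (i == k)%:R.
Proof.
case: i => // i; case: k => // k /= ilt klt.
pose U : 'M[R]_n := \matrix_(j, i) (opoly i.+1).[l j].
pose W : 'M[R]_n := \matrix_(i, j) (christoffel n (l j) * (opoly i.+1).[l j]).
have UW : U *m W = 1%:M.
  apply/matrixP => j k'; rewrite !mxE.
  under eq_bigr do rewrite !mxE mulrCA.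
  rewrite -mulr_sumr -(big_mkord xpredT (fun i => (opoly i.+1).[l j] * (opoly i.+1).[l k'])).
  rewrite -(big_add1 _ _ 0 n.+1 xpredT (fun i => (opoly i).[l j] * (opoly i).[l k'])).
  rewrite opoly_row_orthonormal; have [->|_] := eqVneq j k'; last by rewrite mul0r mulr0.
  by rewrite mul1r divff// gt_eqF// christoffel_gt0.
have /matrixP/(_ (Ordinal ilt) (Ordinal klt)) := mulmx1C UW.
rewrite !mxE /= => <-; apply: eq_bigr => j _; rewrite !mxE/=; by rewrite mulrA.
Qed.

End Quadrature.

End OrthogonalPolynomials.

(** * Weyl's inequalities *)

Section SortedCount.
Context {d : Order.disp_t} {T : orderType d} (x0 : T).
Implicit Types (s : seq T) (y : T).
Local Open Scope order_scope.

Lemma sorted_nth_le s i j : sorted <=%O s -> (i <= j)%N -> (j < size s)%N ->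
  nth x0 s i <= nth x0 s j.
Proof.
move=> ss ij js; apply: (sorted_leq_nth le_trans le_refl) => //.
by rewrite inE (leq_ltn_trans ij).
Qed.

Lemma count_gt_sorted s k y : sorted <=%O s -> (k < size s)%N ->
  y < nth x0 s k -> (size s - k <= count (fun x => (y < x)%O) s)%N.
Proof.
move=> ss ks yk; rewrite -[X in count _ X](cat_take_drop k) count_cat.
rewrite -size_drop (_ : count _ (drop k s) = size (drop k s)) ?leq_addl//.
apply/eqP; rewrite -all_count; apply/(all_nthP x0) => i.
rewrite size_drop ltn_subRL => ik; rewrite nth_drop (lt_le_trans yk)//.
by rewrite sorted_nth_le// leq_addr.
Qed.

Lemma count_gt_nth_sorted s k : sorted <=%O s -> (k < size s)%N ->
  (count (fun x => (nth x0 s k < x)%O) s <= size s - k.+1)%N.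
Proof.
move=> ss ks; set P := fun x => _; rewrite -[X in count _ X](cat_take_drop k.+1) count_cat.
rewrite -size_drop -[leqRHS]add0n leq_add ?count_size//.
rewrite leqNgt -has_count; apply/(has_nthP x0) => -[m].
rewrite size_take_min leq_min => /andP[ik iss].
by rewrite nth_take// /P ltNge sorted_nth_le.
Qed.

Lemma count_lt_sorted s k y : sorted <=%O s -> (k < size s)%N ->
  nth x0 s k < y -> (k.+1 <= count (fun x => (x < y)%O) s)%N.
Proof.
move=> ss ks yk; rewrite -[X in count _ X](cat_take_drop k.+1) count_cat.
have sk : size (take k.+1 s) = k.+1 by rewrite size_take_min; apply/minn_idPl.
suff -> : count (fun x => x < y) (take k.+1 s) = size (take k.+1 s) by rewrite sk leq_addr.
apply/eqP; rewrite -all_count; apply/(all_nthP x0) => i.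
rewrite size_take_min leq_min => /andP[ik _].
by rewrite nth_take// (le_lt_trans _ yk)// sorted_nth_le.
Qed.

Lemma count_lt_nth_sorted s k : sorted <=%O s -> (k < size s)%N ->
  (count (fun x => (x < nth x0 s k)%O) s <= k)%N.
Proof.
move=> ss ks; set P := fun x => _; rewrite -[X in count _ X](cat_take_drop k) count_cat.
have h : size (take k s) = k by rewrite size_take_min; apply/minn_idPl/ltnW.
rewrite -[leqRHS]addn0 leq_add//; first by rewrite -{2}h count_size.
rewrite leqNgt -has_count; apply/(has_nthP x0) => -[m].
rewrite size_drop ltn_subRL => ik.
by rewrite nth_drop /P ltNge sorted_nth_le// leq_addr.
Qed.
End SortedCount.

(** A dimension count: there are [#|~: A| + #|B| < n] linear conditions, so the matrix collecting
    them has a nontrivial left kernel. *)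
Lemma exists_vec_vanishing (F : fieldType) n (U : 'M[F]_n) (A B : {set 'I_n}) :
  (#|B| < #|A|)%N ->
  exists v : 'rV[F]_n, [/\ v != 0, forall j, j \notin A -> (v *m U) 0 j = 0 &
    forall i, i \in B -> v 0 i = 0].
Proof.
move=> AB.
pose G1 : 'M[F]_(n, #|~: A|) := \matrix_(i, j) U i (enum_val j).
pose G2 : 'M[F]_(n, #|B|) := \matrix_(i, j) (i == enum_val j)%:R.
have : kermx (row_mx G1 G2) != 0.
  rewrite -mxrank_eq0 mxrank_ker -lt0n subn_gt0.
  rewrite (leq_ltn_trans (rank_leq_col _))//.
  have cA : (#|A| + #|~: A| = n)%N by rewrite cardsC card_ord.
  by rewrite -[X in (_ < X)%N]cA addnC ltn_add2r.
move=> /rowV0Pn[v /sub_kermxP]; rewrite mul_mx_row -row_mx0 => /eq_row_mx[h1 h2] v0.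
exists v; split => // [j jA|i iB].
  have jA' : j \in ~: A by rewrite inE.
  have /rowP/(_ (enum_rank_in jA' j)) := h1; rewrite !mxE => h; rewrite -[RHS]h.
  by apply: eq_bigr => i _; rewrite mxE enum_rankK_in.
have /rowP/(_ (enum_rank_in iB i)) := h2; rewrite !mxE => h; rewrite -[RHS]h.
rewrite (bigD1 i)//= mxE enum_rankK_in// eqxx mulr1 big1 ?addr0// => k ki.
by rewrite mxE enum_rankK_in// (negPf ki) mulr0.
Qed.

Section Weyl.
Context {R : rcfType} (a b : nat -> R).
Hypothesis a_neq0 : forall n, (1 <= n)%N -> a n != 0.
Variables (n : nat) (l : 'I_n -> R).
Hypothesis n1 : (1 <= n)%N.
Hypothesis l_inj : injective l.
Hypothesis l_root : forall i, (opoly a b n.+1).[l i] = 0.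
Notation p := (opoly a b).
Notation w j := (christoffel a b n (l j)).

(** The coefficient of [v] along the eigenvector [(p_1(l_j), ..., p_n(l_j))] of the truncation,
    which is not normalized; the weight [w j] compensates for this. *)
Definition fourier (v : nat -> R) (j : 'I_n) : R := \sum_(1 <= i < n.+1) (p i).[l j] * v i.

Lemma parseval (v v' : nat -> R) :
  \sum_j w j * (fourier v j * fourier v' j) = \sum_(1 <= i < n.+1) v i * v' i.
Proof.
transitivity (\sum_(1 <= i < n.+1) \sum_(1 <= k < n.+1)
    (\sum_j w j * ((p i).[l j] * (p k).[l j])) * (v i * v' k)).
  transitivity (\sum_j \sum_(1 <= i < n.+1) \sum_(1 <= k < n.+1)
      w j * ((p i).[l j] * (p k).[l j]) * (v i * v' k)).
    apply: eq_bigr => j _; rewrite mulr_suml mulr_sumr.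
    apply: eq_bigr => i _; rewrite !mulr_sumr; apply: eq_bigr => k _; ring.
  rewrite exchange_big; apply: eq_bigr => i _; rewrite exchange_big.
  by apply: eq_bigr => k _; rewrite mulr_suml.
rewrite !big_nat; apply: eq_bigr => i hi; rewrite ltnS in hi.
rewrite (bigD1_seq i) ?mem_index_iota ?iota_uniq//=.
rewrite opoly_col_orthonormal// eqxx mul1r big_nat_cond big1 ?addr0// => k.
rewrite ltnS => /andP[hk ki].
by rewrite opoly_col_orthonormal// eq_sym (negPf ki) mul0r.
Qed.

(** The quadratic form of the truncation in two bases. The transform diagonalizes it because both
    boundary terms of [green_identity] vanish, one with [p_(n+1)(l_j)], the other with [v n.+1]. *)
Lemma parseval_jacobi (v : nat -> R) : v 0%N = 0 -> v n.+1 = 0 ->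
  \sum_j w j * (l j * fourier v j ^+ 2) =
  \sum_(1 <= i < n.+1) b i * v i ^+ 2 +
  \sum_(1 <= i < n.+1) (a i.-1 * v i.-1 * v i + a i * v i * v i.+1).
Proof.
move=> v0 vn; pose Jv i := a i.-1 * v i.-1 + a i * v i.+1 + b i * v i.
have h j : fourier Jv j = l j * fourier v j.
  have ht : three_term a b (l j) (fun i => (p i).[l j]).
    move=> i i1; have := opoly_three_term b a_neq0 idfun (l j) i1.
    by rewrite /= !map_poly_id.
  have := @green_identity _ a b (fun i => (p i).[l j]) v (l j) n (horner0 _) v0 ht.
  by rewrite /= l_root vn mulr0 mul0r subrr mulr0 addr0.
transitivity (\sum_(1 <= i < n.+1) Jv i * v i).
  by rewrite -parseval; apply: eq_bigr => j _; rewrite h; ring.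
by rewrite -big_split/=; apply: eq_bigr => i _; rewrite /Jv; ring.
Qed.

Variable M : R.
Hypothesis a_ge0 : forall i, (1 <= i)%N -> 0 <= a i.
Hypothesis a_leM : forall i, (1 <= i)%N -> a i <= M.

(** After the arithmetic-geometric mean inequality every square occurs at most four times, each time
    with the factor [M / 2]. *)
Lemma offdiag_bound (v : nat -> R) : v 0%N = 0 -> v n.+1 = 0 ->
  `|\sum_(1 <= i < n.+1) (a i.-1 * v i.-1 * v i + a i * v i * v i.+1)| <=
  2 * M * \sum_(1 <= i < n.+1) v i ^+ 2.
Proof.
move=> v0 vn.
have amgm i : `|a i * v i * v i.+1| <= M / 2 * (v i ^+ 2 + v i.+1 ^+ 2).
  case: i => [|i]; first by rewrite v0 mulr0 mul0r normr0 expr0n add0r mulr_ge0 ?sqr_ge0//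
    divr_ge0// (le_trans (a_ge0 (isT : (1 <= 1)%N)))// a_leM.
  rewrite -mulrA normrM ger0_norm ?a_ge0//.
  have h : `|v i.+1 * v i.+2| <= (v i.+1 ^+ 2 + v i.+2 ^+ 2) / 2.
    rewrite normrM -(real_normK (num_real (v i.+1))) -(real_normK (num_real (v i.+2))).
    have := sqr_ge0 (`|v i.+1| - `|v i.+2|); lra.
  rewrite (le_trans (ler_pM _ _ (a_leM _) h))// ?a_ge0//; lra.
set S := \sum_(1 <= i < n.+1) v i ^+ 2.
have s1 : \sum_(1 <= i < n.+1) v i.-1 ^+ 2 <= S.
  rewrite /S; case: (n) => [|m]; first by rewrite !big_geq.
  rewrite [leLHS]big_ltn//= v0 expr0n add0r [leLHS]big_add1/=.
  by rewrite [leRHS]big_nat_recr//= lerDl sqr_ge0.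
have s2 : \sum_(1 <= i < n.+1) v i.+1 ^+ 2 <= S.
  rewrite /S; case: (n) vn => [|m] vm; first by rewrite !big_geq.
  rewrite [leLHS]big_nat_recr//= vm expr0n addr0.
  by rewrite [leRHS]big_ltn//= [X in _ <= _ + X]big_add1/= lerDr sqr_ge0.
apply: (@le_trans _ _ (\sum_(1 <= i < n.+1)
    (M / 2 * (v i.-1 ^+ 2 + v i ^+ 2) + M / 2 * (v i ^+ 2 + v i.+1 ^+ 2)))).
  rewrite (le_trans (ler_norm_sum _ _ _))// !big_nat ler_sum// => -[//|i] _.
  by rewrite (le_trans (ler_normD _ _))// lerD.
rewrite big_split/= -!mulr_sumr !big_split/= -/S.
have M0 : 0 <= M by rewrite (le_trans (a_ge0 n1))// a_leM.
nra.
Qed.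

(* Used with [s = 1] and [s = -1]. A nonzero [v] whose spectral support lies in the
   left-hand set and which vanishes on the right-hand set would contradict
   [<v, J v>] being within [2 M |v|^2] of [\sum_i b_i v_i^2]. *)
Lemma weyl_card (s x : R) : `|s| <= 1 ->
  (#|[set j : 'I_n | (2 * M < s * (l j - x))%R]| <= #|[set i : 'I_n | (0 < s * (b i.+1 - x))%R]|)%N.
Proof.
move=> s1; rewrite leqNgt; apply/negP => AB.
pose U : 'M[R]_n := \matrix_(i, j) (p i.+1).[l j].
have [V [V0 VA VB]] := exists_vec_vanishing U AB.
have [v [v0 vn vE]] : exists v : nat -> R,
    [/\ v 0%N = 0, v n.+1 = 0 & forall i : 'I_n, v i.+1 = V 0 i].
  exists (fun i => if i is i'.+1 then oapp (V 0) 0 (insub i') else 0).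
  by split=> [//||i]; rewrite ?valK// insubF// ltnn.
have fE j : fourier v j = (V *m U) 0 j.
  rewrite /fourier big_add1/= big_mkord mxE; apply: eq_bigr => i _.
  by rewrite mxE vE mulrC.
have S_gt0 : 0 < \sum_(1 <= i < n.+1) v i ^+ 2.
  rewrite big_add1/= big_mkord; have /rV0Pn[i Vi] := V0.
  rewrite (bigD1 i)//= ltr_pwDl ?sumr_ge0// => [|k _]; last exact: sqr_ge0.
  by rewrite vE exprn_even_gt0.
have e1 : \sum_(1 <= i < n.+1) v i ^+ 2 = \sum_j w j * fourier v j ^+ 2.
  under [RHS]eq_bigr do rewrite expr2.
  by rewrite parseval; apply: eq_bigr => i _; rewrite expr2.
have := parseval_jacobi v0 vn.
have := offdiag_bound v0 vn; set O := \sum_(1 <= i < n.+1) (_ + _).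
move=> hO hJ.
(* Off the left-hand set the coefficients vanish, on it the factor exceeds [2 * M]; some nonzero
   coefficient, necessarily in that set, makes the inequality strict. *)
have h1 : 2 * M * \sum_(1 <= i < n.+1) v i ^+ 2 <
    \sum_j w j * (s * (l j - x) * fourier v j ^+ 2).
  have le j : 2 * M * (w j * fourier v j ^+ 2) <= w j * (s * (l j - x) * fourier v j ^+ 2).
    rewrite mulrCA ler_pM2l ?christoffel_gt0//.
    have [jA|jA] := boolP (j \in [set j : 'I_n | 2 * M < s * (l j - x)]).
      by rewrite ler_wpM2r ?sqr_ge0// ltW//; move: jA; rewrite inE.
    by rewrite fE VA// expr0n !mulr0.
  rewrite e1 mulr_sumr.
  have [j fj] : exists j, fourier v j != 0.
    apply/existsP; apply: contraPT S_gt0 => /existsPn h.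
    rewrite e1 big1 ?ltxx// => j _; have /negPn/eqP -> := h j.
    by rewrite expr0n mulr0.
  rewrite (bigD1 j)//= [ltRHS](bigD1 j)//= ltr_leD// ?ler_sum//.
  rewrite mulrCA ltr_pM2l ?christoffel_gt0// ltr_pM2r ?exprn_even_gt0//.
  have [|jA] := boolP (j \in [set j : 'I_n | 2 * M < s * (l j - x)]); first by rewrite inE.
  by move: fj; rewrite fE VA// eqxx.
have h2 : \sum_(1 <= i < n.+1) s * (b i - x) * v i ^+ 2 <= 0.
  rewrite big_add1/= big_mkord; apply: sumr_le0 => i _; rewrite vE.
  have [iB|] := boolP (i \in [set i : 'I_n | 0 < s * (b i.+1 - x)]).
    by rewrite VB// expr0n mulr0.
  by rewrite inE -leNgt => ?; rewrite mulr_le0_ge0// sqr_ge0.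
have h3 : \sum_j w j * (s * (l j - x) * fourier v j ^+ 2) =
   \sum_(1 <= i < n.+1) s * (b i - x) * v i ^+ 2 + s * O.
  transitivity (s * (\sum_j w j * (l j * fourier v j ^+ 2)) -
      s * x * \sum_j w j * fourier v j ^+ 2).
    rewrite !mulr_sumr -sumrB; apply: eq_bigr => j _; ring.
  rewrite hJ -e1 mulrDr addrAC; congr (_ + _).
  by rewrite !mulr_sumr -sumrB; apply: eq_bigr => i _; ring.
have h4 : s * O <= 2 * M * \sum_(1 <= i < n.+1) v i ^+ 2.
  rewrite (le_trans (ler_norm _))// normrM (le_trans _ hO)//.
  by rewrite -[leRHS]mul1r ler_wpM2r.
by move: h1; rewrite h3 ltNge -[leRHS]add0r lerD.
Qed.

Let ls := sort <=%R [seq l j | j <- enum 'I_n].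
Let bs := sort <=%R [seq b i | i <- iota 1 n].

Lemma count_iota1 (P : pred R) : count P [seq b i | i <- iota 1 n] = #|[set i : 'I_n | P (b i.+1)]|.
Proof.
rewrite count_map -[1%N]addn0 iotaDl count_map -val_enum_ord count_map.
by rewrite -sum1_count big_enum_cond -sum1_card; apply: eq_bigl => i; rewrite !inE.
Qed.

(** If the eigenvalue of rank [k] were below [bs_k - 2 * M], so would be [k + 1] eigenvalues; by
    [weyl_card] with [s = -1], at least [k + 1] of the [b_i] would lie below [bs_k], but at most [k]
    do. The other side uses [s = 1]. *)
Lemma weyl_sorted k : (k < n)%N -> `|ls`_k - bs`_k| <= 2 * M.
Proof.
move=> kn.
have sls : size ls = n by rewrite size_sort size_map size_enum_ord.
have sbs : size bs = n by rewrite size_sort size_map size_iota.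
have ols : sorted <=%O ls by apply: sort_sorted; exact: le_total.
have obs : sorted <=%O bs by apply: sort_sorted; exact: le_total.
have cls (P : pred R) : count P ls = #|[set j : 'I_n | P (l j)]|.
  rewrite count_sort count_map -sum1_count big_enum_cond -sum1_card.
  by apply: eq_bigl => i; rewrite !inE.
have cbs (P : pred R) : count P bs = #|[set i : 'I_n | P (b i.+1)]|.
  by rewrite count_sort count_iota1.
rewrite ler_norml; apply/andP; split; rewrite leNgt; apply/negP => h.
- have h1 := @count_lt_sorted _ _ 0 ls k (bs`_k - 2 * M) ols.
  rewrite sls in h1; have {}h1 := h1 kn; rewrite cls in h1.
  have h2 := @count_lt_nth_sorted _ _ 0 bs k obs; rewrite sbs in h2.
  have {}h2 := h2 kn; rewrite cbs in h2.
  have := @weyl_card (-1) bs`_k; rewrite normrN1 lexx => /(_ isT) h3.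
  suff : (k.+1 <= k)%N by rewrite ltnn.
  apply: (leq_trans (h1 _)); first by lra.
  apply: (leq_trans _ h2); apply: (leq_trans _ (leq_trans h3 _)).
    by apply/subset_leq_card/fintype.subsetP => j; rewrite !inE; lra.
  by apply/subset_leq_card/fintype.subsetP => j; rewrite !inE; lra.
- have h1 := @count_gt_sorted _ _ 0 ls k (bs`_k + 2 * M) ols.
  rewrite sls in h1; have {}h1 := h1 kn; rewrite cls in h1.
  have h2 := @count_gt_nth_sorted _ _ 0 bs k obs; rewrite sbs in h2.
  have {}h2 := h2 kn; rewrite cbs in h2.
  have := @weyl_card 1 bs`_k; rewrite normr1 lexx => /(_ isT) h3.
  suff : (n - k <= n - k.+1)%N.
    by rewrite subnS; case: (n - k)%N (subn_gt0 k n) kn => [|m] //= <-; rewrite ?ltnn.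
  apply: (leq_trans (h1 _)); first by lra.
  apply: (leq_trans _ h2); apply: (leq_trans _ (leq_trans h3 _)).
    by apply/subset_leq_card/fintype.subsetP => j; rewrite !inE; lra.
  by apply/subset_leq_card/fintype.subsetP => j; rewrite !inE; lra.
Qed.

(** [q] lists the eigenvalues whose partner of equal rank among the [b_i] satisfies [P]. It is
    chosen before [E] and [d], so that one monic polynomial serves the whole window. *)
Lemma weyl_product (P : pred R) : exists2 q : seq R,
  size q = count P [seq b i | i <- iota 1 n] &
  forall (E : R) (d : R -> R), (forall x, ~~ P x -> 0 <= d x) ->
    (forall x y, ~~ P x -> `|y - x| <= 2 * M -> d x <= `|E - y|) ->
    (\prod_(1 <= i < n.+1 | ~~ P (b i)) d (b i)) * (\prod_(y <- q) `|E - y|) <=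
    \prod_j `|E - l j|.
Proof.
have sls : size ls = n by rewrite size_sort size_map size_enum_ord.
have sbs : size bs = n by rewrite size_sort size_map size_iota.
exists [seq ls`_k | k <- iota 0 n & P bs`_k].
  rewrite size_map size_filter -(count_sort <=%R) -/bs -[in RHS](mkseq_nth 0 bs) sbs.
  by rewrite /mkseq count_map.
move=> E d d0 hd.
have -> : \prod_j `|E - l j| = \prod_(0 <= k < n) `|E - ls`_k|.
  transitivity (\prod_(y <- ls) `|E - y|); last by rewrite (big_nth 0) sls.
  rewrite (perm_big [seq l j | j <- enum 'I_n]) ?perm_sort//.
  by rewrite big_map big_enum.
have -> : \prod_(1 <= i < n.+1 | ~~ P (b i)) d (b i) =
    \prod_(0 <= k < n | ~~ P bs`_k) d bs`_k.
  transitivity (\prod_(y <- bs | ~~ P y) d y); last by rewrite (big_nth 0) sbs.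
  rewrite [RHS](perm_big [seq b i | i <- iota 1 n]) ?perm_sort//.
  by rewrite big_map /index_iota subSS subn0.
rewrite big_map big_filter [leRHS](bigID (fun k => P bs`_k))/= [leRHS]mulrC.
rewrite /index_iota subn0 ler_wpM2r ?prodr_ge0//.
rewrite big_seq_cond [leRHS]big_seq_cond; apply: ler_prod => k.
rewrite mem_iota add0n => /andP[kn nP]; rewrite d0//=.
by rewrite hd// weyl_sorted.
Qed.

End Weyl.

Local Open Scope classical_set_scope.
Local Open Scope ring_scope.

(** * Polya's inequality *)

(** Interpolation at [n + 1] nodes reproduces [f]; now compare coefficients of degree [n], each
    basis polynomial [L i] being monic of that degree. *)
Lemma lagrange_lead_coef (F : fieldType) n (x : 'I_n.+1 -> F) (f : {poly F}) :
  injective x -> (size f <= n.+1)%N ->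
  \sum_i f.[x i] / (\prod_(k | k != i) (x i - x k)) = f`_n.
Proof.
move=> xI sf; pose L i := \prod_(k | k != i) ('X - (x k)%:P).
pose c i := \prod_(k | k != i) (x i - x k).
have c0 i : c i != 0.
  by apply/prodf_neq0 => k ki; rewrite subr_eq0 inj_eq// eq_sym.
have LE i j : (L i).[x j] = if i == j then c i else 0.
  rewrite /L horner_prod; have [<-|ij] := eqVneq i j.
    by apply: eq_bigr => k _; rewrite hornerXsubC.
  rewrite (bigD1 j)/=; last by rewrite eq_sym.
  by rewrite hornerXsubC subrr mul0r.
have sL i : size (L i) = n.+1.
  rewrite /L -big_filter size_prod_XsubC size_filter -sum1_count; congr _.+1.
  by have := cardC1 i; rewrite card_ord -sum1_card.
pose g := \sum_i (f.[x i] / c i) *: L i.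
suff -> : f = g.
  rewrite /g coef_sum; apply: eq_bigr => i _; rewrite coefZ.
  have -> : (L i)`_n = 1.
    have /monicP := monic_prod_XsubC (index_enum 'I_n.+1) (fun k => k != i) x.
    by rewrite lead_coefE -/(L i) sL.
  rewrite mulr1 -/(c i); congr (_ / _).
  rewrite horner_sum (bigD1 i)//= hornerZ LE eqxx mulfVK// big1 ?addr0// => k ki.
  by rewrite hornerZ LE (negPf ki) mulr0.
apply/eqP; rewrite -subr_eq0; apply/eqP.
apply: (@roots_geq_poly_eq0 _ _ [seq x i | i <- enum 'I_n.+1]).
- apply/allP => _ /mapP[i _ ->]; rewrite /root hornerD hornerN subr_eq0 horner_sum.
  rewrite (bigD1 i)//= hornerZ LE eqxx mulfVK// big1 ?addr0// => k ki.
  by rewrite hornerZ LE (negPf ki) mulr0.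
- by rewrite map_inj_uniq// enum_uniq.
rewrite size_map size_enum_ord (leq_trans (size_polyD _ _))// geq_max sf size_polyN.
apply: (leq_trans (size_sum _ _ _)); apply/bigmax_leqP => i _.
by rewrite (leq_trans (size_scale_leq _ _))// sL.
Qed.

(** * Chebyshev polynomials of the first kind and their extremal points *)

Fixpoint chebyshev_pair (F : comNzRingType) (n : nat) : {poly F} * {poly F} :=
  if n is m.+1 then let: (p, q) := chebyshev_pair F m in (q, 2 *: ('X * q) - p)
  else (1, 'X).

Definition chebyshev (F : comNzRingType) n := (chebyshev_pair F n).1.

Section Chebyshev.
Context {R : realType}.
Notation T := (chebyshev R).

Lemma chebyshevSS n : T n.+2 = 2 *: ('X * T n.+1) - T n.
Proof. by rewrite /chebyshev /=; case: (chebyshev_pair R n). Qed.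

Lemma chebyshev_size_lead n : size (T n.+1) = n.+2 /\ lead_coef (T n.+1) = 2 ^+ n.
Proof.
suff : [/\ (size (T n) <= n.+1)%N, size (T n.+1) = n.+2 & lead_coef (T n.+1) = 2 ^+ n] by case.
elim: n => [|n [IH1 IH2 IH3]].
  by rewrite size_poly1 size_polyX lead_coefX.
have T0 : T n.+1 != 0 by rewrite -size_poly_eq0 IH2.
have s2 : size (2 *: ('X * T n.+1)) = n.+3.
  by rewrite size_scale ?pnatr_eq0// mulrC size_mulX// IH2.
have sl : (size (- T n) < size (2 *: ('X * T n.+1))%R)%N.
  by rewrite s2 size_polyN ltnW// ltnS.
split; first by rewrite IH2.
  by rewrite chebyshevSS size_polyDl.
by rewrite chebyshevSS lead_coefDl// lead_coefZ lead_coefM lead_coefX mul1r IH3 exprS.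
Qed.

Lemma chebyshev_cos n (t : R) : (T n).[cos t] = cos (n%:R * t).
Proof.
suff : (T n).[cos t] = cos (n%:R * t) /\ (T n.+1).[cos t] = cos (n.+1%:R * t) by case.
elim: n => [|n [IH1 IH2]]; first by rewrite hornerC hornerX mul0r cos0 mul1r.
split=> //; rewrite chebyshevSS hornerD hornerN hornerZ hornerM hornerX IH1 IH2.
have -> : n.+2%:R * t = n.+1%:R * t + t by rewrite -[in LHS]natr1; ring.
have -> : n%:R * t = n.+1%:R * t - t by rewrite -[in RHS]natr1; ring.
by rewrite cosB cosD; ring.
Qed.

(** The points where [T_n] attains its extreme values on [[-1, 1]], not its zeros, numbered from
    right to left. *)
Definition cheb_node n (i : 'I_n.+1) : R := cos (i%:R * pi / n%:R).

Lemma cos_natpi k : cos (k%:R * pi) = (-1) ^+ k :> R.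
Proof.
elim: k => [|k IH]; first by rewrite mul0r cos0.
by rewrite -natr1 mulrDl mul1r cosDpi IH exprS mulN1r.
Qed.

Lemma chebyshev_node n (i : 'I_n.+1) : (0 < n)%N -> (T n).[cheb_node i] = (-1) ^+ i.
Proof.
by move=> n0; rewrite chebyshev_cos mulrC divfK ?cos_natpi// pnatr_eq0 -lt0n.
Qed.

Lemma cheb_node_lt n (i k : 'I_n.+1) : (0 < n)%N -> (i < k)%N -> cheb_node k < cheb_node i.
Proof.
move=> n0 ik; have bd (j : 'I_n.+1) : j%:R * pi / n%:R \in `[0, pi : R].
  rewrite in_itv/= divr_ge0 ?mulr_ge0 ?pi_ge0//=.
  rewrite ler_pdivrMr ?ltr0n// mulrC ler_wpM2l ?pi_ge0// ler_nat.
  by rewrite -ltnS.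
rewrite /cheb_node ltr_cos// ltr_pM2r ?invr_gt0 ?ltr0n// ltr_pM2r ?pi_gt0//.
by rewrite ltr_nat.
Qed.

Lemma cheb_node_inj n : (0 < n)%N -> injective (@cheb_node n).
Proof.
move=> n0 i k e; apply/val_inj/eqP; rewrite eqn_leq.
by apply/andP; split; rewrite leqNgt; apply/negP => /(cheb_node_lt n0); rewrite e ltxx.
Qed.

(** Lagrange's formula for the leading coefficient [2^(n-1)] of [T_n]. Values and denominators carry
    the same sign [(-1)^i], so every summand equals its absolute value. *)
Lemma sum_cheb_node n : (0 < n)%N ->
  \sum_i (\prod_(k | k != i) `|@cheb_node n i - cheb_node k|)^-1 = 2 ^+ n.-1.
Proof.
case: n => // n _; have [sT lT] := chebyshev_size_lead n.
have := @lagrange_lead_coef R n.+1 (@cheb_node n.+1) (T n.+1) (cheb_node_inj (ltn0Sn n)).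
rewrite sT leqnn => /(_ isT).
have -> : (T n.+1)`_n.+1 = 2 ^+ n by rewrite -lT lead_coefE sT.
move=> <-.
apply: eq_bigr => i _; rewrite chebyshev_node//.
suff -> : \prod_(k | k != i) (cheb_node i - cheb_node k) =
    (-1) ^+ i * \prod_(k | k != i) `|cheb_node i - cheb_node k|.
  by rewrite invfM mulrA divff ?mul1r// signr_eq0.
(* Exactly [i] nodes lie to the right of node [i], and each gives one negative factor. *)
have -> : (-1) ^+ i = \prod_(k < n.+2 | k != i) (if (k < i)%N then -1 else 1) :> R.
  rewrite -big_mkcondr/= prodr_const; congr (_ ^+ _).
  rewrite -[LHS](card_ord i).
  have h : (i <= n.+2)%N by rewrite ltnW.
  have hI : injective (widen_ord h) by move=> j k /(congr1 val) /= /val_inj.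
  rewrite -(fintype.card_image hI).
  apply: eq_card => k; apply/fintype.imageP/idP; rewrite /in_mem /=.
    by move=> [j _ ->]; rewrite /= ltn_ord andbT -val_eqE/= ltn_eqF.
  by move=> /andP[_ ki]; exists (Ordinal ki) => //; exact: val_inj.
rewrite -big_split/=; apply: eq_bigr => k ki; case: ifPn => ik.
  by rewrite ltr0_norm ?mulN1r ?opprK// subr_lt0 cheb_node_lt.
rewrite mul1r gtr0_norm// subr_gt0 cheb_node_lt// ltn_neqAle eq_sym val_eqE ki.
by rewrite leqNgt.
Qed.
End Chebyshev.

(** * Well-spread points in a compact set, and the measure of sublevel sets *)

Section CompactSelection.
Context {R : realType}.
Notation mu := (@lebesgue_measure R).

Lemma compact_measure_fin (S : set R) : compact S -> (mu S < +oo)%E.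
Proof.
move=> cS; have [M [_ MS]] := compact_bounded cS.
apply: (@le_lt_trans _ _ (mu `[- (M + 1), M + 1])).
  apply: le_outer_measure => x Sx; rewrite /= in_itv/= -ler_norml.
  by apply: MS => //; rewrite ltrDl.
rewrite lebesgue_measure_itv; case: ifP => _; last by rewrite ltry.
by rewrite -EFinD ltry.
Qed.

(* The map [x |-> |S ∩ (-oo, x]|] is 1-Lipschitz and already maps [S] onto [0, |S|]. *)
Lemma compact_measure_section (S : set R) (I : Type) (s : I -> R) : S !=set0 -> compact S ->
  (forall i, 0 <= s i <= fine (mu S)) ->
  exists2 x : I -> R, (forall i, S (x i)) & forall i k, `|s i - s k| <= `|x i - x k|.
Proof.
move=> S0 cS hs.
have mS : measurable S by exact: compact_measurable.
pose phi x := mu (S `&` `]-oo, x]).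
have mphi x : measurable (S `&` `]-oo, x]) by exact: measurableI.
have phifin x : phi x \is a fin_num.
  rewrite ge0_fin_numE ?measure_ge0// (le_lt_trans _ (compact_measure_fin cS))//.
  by apply: le_outer_measure; exact: subIsetl.
have phimono x y : x <= y -> (phi x <= phi y)%E.
  move=> xy; apply: le_outer_measure => z [Sz]; rewrite /= !in_itv/= => zx.
  by split=> //; exact: le_trans zx xy.
have phiE x y : x <= y -> phi y = (phi x + mu (S `&` `]x, y]))%E.
  move=> xy; rewrite /phi -measureU; last 3 first.
  - exact: mphi.
  - exact: measurableI.
  - apply/seteqP; split => // z [[_ zx] [_ yz]]; move: zx yz; rewrite /= !in_itv/=.
    by move=> zx /andP[]; rewrite ltNge zx.
  by rewrite -setIUr -itv_bndbnd_setU.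
have philip x y : x <= y -> fine (phi y) - fine (phi x) <= y - x.
  move=> xy; rewrite -lee_fin EFinB !fineK// (phiE _ _ xy) addeAC subee// add0e.
  have -> : (y - x)%:E = mu `]x, y].
    rewrite lebesgue_measure_itv/= lte_fin; case: ltP => // yx.
    have -> : y = x by apply/le_anti; rewrite xy yx.
    by rewrite subrr.
  by apply: le_outer_measure; exact: subIsetr.
have phisep x y : `|fine (phi x) - fine (phi y)| <= `|x - y|.
  wlog xy : x y / x <= y => [wl|].
    case: (leP x y) => [|/ltW] xy; first exact: wl.
    by rewrite distrC (distrC x y); exact: wl.
  rewrite distrC (distrC x y) !ger0_norm ?subr_ge0 ?philip// fine_le//.
  exact: phimono.
have sel t : 0 <= t <= fine (mu S) -> exists2 x, S x & fine (phi x) = t.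
  move=> /andP[t0 tm]; have [M [_ MS]] := compact_bounded cS.
  have {}MS x : S x -> - (M + 1) <= x <= M + 1.
    by move=> Sx; rewrite -ler_norml; apply: MS => //; rewrite ltrDl.
  have [x0 Sx0] := S0.
  have M0 : - (M + 1) <= M + 1 by have /andP[/le_trans] := MS _ Sx0; exact.
  have pM : phi (M + 1) = mu S.
    rewrite /phi setIidl// => x /MS/andP[_]; by rewrite /= in_itv.
  have pN x : (forall y, S y -> x <= y) -> phi x = 0%E.
    move=> h; apply/eqP; rewrite -measure_le0 -(lebesgue_measure_set1 x).
    apply: le_outer_measure => y [/h xy]; rewrite /= in_itv/= => yx.
    by apply/le_anti; rewrite xy yx.
  have pNM : phi (- (M + 1)) = 0%E by apply: pN => y /MS/andP[].
  have [||u _ ut] := @IVT R (fine \o phi) (- (M + 1)) (M + 1) t M0.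
  - apply: continuous_subspaceT => x.
    have /cvgrPdist_le idc : y @[y --> x] --> x by exact: cvg_id.
    apply/cvgrPdist_le => e e0; apply: filterS (idc e e0) => y /=.
    exact: le_trans (phisep _ _).
  - by rewrite /= pNM pM/= minEle maxEle (le_trans t0 tm) t0 tm.
  have clS : closed S by apply: compact_closed => //; exact: Rhausdorff.
  (* [u] may lie outside [S]. The largest point of [S] to its left cuts off the same part of [S]; if
     there is none, then [t = 0] and the smallest point of [S] will do. *)
  have [Su|Su] := pselect (exists2 y, S y & y <= u).
    pose B := S `&` `]-oo, u].
    have hB : has_sup B.
      split; first by have [y Sy yu] := Su; exists y.
      by exists u => y [_]; rewrite /= in_itv.
    have clB : closed B by apply: closedI => //; exact: interval_closed.
    have BB : B (sup B).
      rewrite -[X in X _]/(B) ; have := closure_sup hB.1 hB.2.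
      by move/closure_id : clB => <-.
    exists (sup B); first exact: BB.1.
    rewrite -ut /= /phi; congr (fine (mu _)); apply/seteqP; split => y [Sy yb]; split => //.
      move: yb BB.2; rewrite /= !in_itv/=; exact: le_trans.
    rewrite /= in_itv/=; apply: ub_le_sup; first exact: hB.2.
    by split.
  have t00 : t = 0.
    rewrite -ut /= /phi (_ : S `&` _ = set0) ?measure0//.
    by apply/seteqP; split=> // y [Sy yu]; apply: Su; exists y.
  have hS : has_inf S.
    by split => //; exists (- (M + 1)) => y /MS/andP[].
  have SS : S (inf S).
    suff : closure S (inf S) by move/closure_id : clS => <-.
    move=> B /nbhs_ballP[e /= e0 eB].
    have [y Sy ye] := inf_adherent e0 hS; exists y; split => //; apply: eB.
    have := ge_inf hS.2 Sy; rewrite /ball/= distrC => iy.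
    rewrite ger0_norm ?subr_ge0//; move: ye iy; lra.
  exists (inf S) => //; rewrite t00 pN// => y Sy; apply: ge_inf => //; exact: hS.2.
pose x i := sval (cid2 (sel _ (hs i))).
exists x => [i|i k]; rewrite /x; first by case: cid2.
by case: cid2 => /= y _ <-; case: cid2 => /= z _ <-.
Qed.

Lemma sublevel_compact (q : seq R) (eta : R) : (0 < size q)%N ->
  compact [set x : R | \prod_(y <- q) `|x - y| <= eta].
Proof.
case: q => // y0 q _.
have cont : continuous (fun x : R => \prod_(y <- y0 :: q) `|x - y|).
  move=> x; apply: cvg_big => [z|y _]; first exact: mul_continuous.
  by apply: cvg_norm; apply: cvgB => //; exact: cvg_cst.
(* Beyond [M] every factor exceeds [1 + |eta|]: one of them beats [eta] and the others are at least
   1. *)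
pose M := \big[Num.max/0]_(y <- y0 :: q) `|y| + 1 + `|eta|.
apply: (@subclosed_compact _ _ `[- M, M]); last 2 first.
- exact: segment_compact.
- move=> x /= hx; rewrite /= in_itv/= -ler_norml leNgt; apply/negP => xM.
  move: hx; apply/negP; rewrite -ltNge.
  have far y : y \in y0 :: q -> 1 + `|eta| < `|x - y|.
    move=> yq; have : `|y| <= \big[Num.max/0]_(y <- y0 :: q) `|y| by exact: le_bigmax_seq.
    have := lerB_normD x (- y); rewrite normrN. move: xM; rewrite /M; lra.
  rewrite big_cons -[ltLHS]mulr1 (@lt_le_trans _ _ (`|x - y0| * 1))//.
    rewrite !mulr1 (le_lt_trans (ler_norm _))//.
    have := far y0 (mem_head _ _); have := normr_ge0 eta; lra.
  rewrite ler_wpM2l// big_seq; elim/big_ind: _ => // [u v u1 v1|y yq].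
    by rewrite -[leLHS]mulr1 ler_pM.
  have := far y; rewrite inE yq orbT => /(_ isT); have := normr_ge0 eta; lra.
have -> : [set x : R | \prod_(y <- y0 :: q) `|x - y| <= eta] =
    (fun x : R => \prod_(y <- y0 :: q) `|x - y|) @^-1` [set z | z <= eta] by [].
by apply: preimage_closed => //; exact: closed_le.
Qed.

(* Interpolate at points of the sublevel set that are at least as far apart as the
   Chebyshev nodes of an interval of the same length. *)
Lemma polya_ineq (q : seq R) (eta : R) : (0 < size q)%N -> 0 < eta ->
  (mu [set x : R | (\prod_(y <- q) `|x - y| <= eta)%R] <=
   (4 * (eta / 2) `^ (size q)%:R^-1)%:E)%E.
Proof.
move=> q0 eta0; set S := [set x | _]; set n := size q.
have cS : compact S by exact: sublevel_compact.
have mfin : mu S \is a fin_num.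
  by rewrite ge0_fin_numE ?measure_ge0// compact_measure_fin.
rewrite -(fineK mfin) lee_fin; set m := fine (mu S).
have : 0 <= m by rewrite fine_ge0.
rewrite le_eqVlt => /predU1P[<-|m0]; first by rewrite mulr_ge0// powR_ge0.
have S0 : S !=set0.
  by apply/set0P/negP => /eqP S0; move: m0; rewrite /m S0 measure0 ltxx.
(* The Chebyshev nodes moved affinely from [[-1, 1]] to [[0, m]]. *)
pose s (i : 'I_n.+1) : R := m / 2 * (1 + cheb_node i).
have hs i : 0 <= s i <= m.
  have := cos_geN1 (i%:R * pi / n%:R : R); have := cos_le1 (i%:R * pi / n%:R : R).
  rewrite /s /cheb_node; nra.
have [x Sx sx] := compact_measure_section S0 cS hs.
have ct i k : m / 2 * `|cheb_node i - cheb_node k| <= `|x i - x k|.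
  have -> : m / 2 * `|cheb_node i - cheb_node k| = `|s i - s k|.
    rewrite /s -mulrBr normrM [in RHS]ger0_norm; last by rewrite divr_ge0// ltW.
    by congr (_ * `|_|); ring.
  exact: sx.
have ctp i k : k != i -> 0 < m / 2 * `|@cheb_node R n i - cheb_node k|.
  move=> ki; rewrite mulr_gt0 ?divr_gt0// normr_gt0 subr_eq0 inj_eq 1?eq_sym//.
  exact: cheb_node_inj.
have xI : injective x.
  move=> i k xik; apply/eqP/negPn/negP => ik.
  have := lt_le_trans (ctp _ _ ik) (ct k i); rewrite xik subrr normr0 ltxx//.
pose f := \prod_(y <- q) ('X - y%:P).
have := @lagrange_lead_coef R n x f xI; rewrite size_prod_XsubC leqnn => /(_ isT).
have -> : f`_n = 1.
  have := monic_prod_XsubC q xpredT id; rewrite monicE lead_coefE size_prod_XsubC.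
  by move/eqP.
move=> hL.
(* Lagrange's formula for the monic [f]: the numerators are at most [eta] on [S], and the
   denominators dominate those of the scaled Chebyshev nodes, whose inverses are summed by
   [sum_cheb_node]. *)
have key : 1 <= eta * (2 / m) ^+ n * 2 ^+ n.-1.
  rewrite -(@sum_cheb_node R _ q0) -[leLHS]hL mulr_sumr ler_sum// => i _.
  rewrite (le_trans (ler_norm _))// normrM normfV.
  have nf : `|f.[x i]| <= eta.
    rewrite /f horner_prod normr_prod; have := Sx i; rewrite /S /=.
    by under [in X in _ -> X]eq_bigr do rewrite hornerXsubC.
  rewrite -mulrA ler_pM ?invr_ge0//.
  have -> : (2 / m) ^+ n = (\prod_(k : 'I_n.+1 | k != i) (m / 2))^-1.
    rewrite prodr_const -exprVn invf_div; congr (_ ^+ _).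
    by have := cardC1 i; rewrite card_ord.
  rewrite -invfM -big_split/= lef_pV2 ?posrE.
  - rewrite normr_prod; apply: ler_prod => k ki; rewrite ct andbT.
    by rewrite ltW// ctp.
  - rewrite normr_gt0; apply/prodf_neq0 => k ki.
    by rewrite subr_eq0 inj_eq// eq_sym.
  - by apply: prodr_gt0 => k ki; rewrite ctp.
have mn : (m / 4) ^+ n <= eta / 2.
  have n0 : (0 < n)%N := q0.
  move: key; case: (n) n0 => // n' _ /=.
  rewrite !expr_div_n => key.
  have e4 : 4 ^+ n'.+1 = 2 * (2 ^+ n'.+1 * 2 ^+ n') :> R.
    have -> : 4 = 2 * 2 :> R by ring.
    by rewrite exprMn exprS; ring.
  have mp : 0 < m ^+ n'.+1 by rewrite exprn_gt0.
  rewrite ler_pdivrMr ?exprn_gt0// e4.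
  move: key; rewrite (_ : _ * _ * _ = eta * (2 ^+ n'.+1 * 2 ^+ n') / m ^+ n'.+1).
    2: by ring.
  rewrite ler_pdivlMr// mul1r => key.
  by apply: le_trans key _; rewrite le_eqVlt; apply/orP; left; apply/eqP; field.
rewrite -ler_pdivrMl// mulrC.
have -> : m / 4 = ((m / 4) ^+ n) `^ (n%:R^-1).
  rewrite -powR_mulrn ?divr_ge0 ?ltW// -powRrM mulfV ?powRr1 ?divr_ge0 ?ltW//.
  by rewrite pnatr_eq0 -lt0n.
apply: ge0_ler_powR => //; rewrite nnegrE; last by rewrite divr_ge0// ltW.
by rewrite exprn_ge0// divr_ge0// ltW.
Qed.

End CompactSelection.

(** * Poisson integrals of finite measures *)

Section Poisson.
Context {R : realType}.
Notation mu := (@lebesgue_measure R).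

Lemma bigcup_measure_le (F : nat -> set R) (M : \bar R) :
  (forall i, measurable (F i)) -> nondecreasing_seq F ->
  (forall i, (mu (F i) <= M)%E) -> (mu (\bigcup_i F i) <= M)%E.
Proof.
move=> mF ndF FM.
have h : mu \o F @ \oo --> mu (\bigcup_n F n).
  by apply: nondecreasing_cvg_mu => //; exact: bigcupT_measurable.
rewrite -(cvg_lim _ h)//; apply: lime_le; first by apply/cvg_ex; eexists; exact: h.
by apply: nearW => n; exact: FM.
Qed.

(** The imaginary part of [1 / (l - x - i e)], that is, the Poisson kernel without its factor
    [1 / pi]. *)
Definition poisson (l e x : R) : R := e / ((l - x) ^+ 2 + e ^+ 2).

Lemma poisson_denom_gt0 (l e x : R) : 0 < e -> 0 < (l - x) ^+ 2 + e ^+ 2.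
Proof. by move=> e0; rewrite ltr_wpDl ?sqr_ge0// exprn_gt0. Qed.

Lemma poisson_ge0 (l e x : R) : 0 < e -> 0 <= poisson l e x.
Proof. by move=> e0; rewrite divr_ge0// ltW// poisson_denom_gt0. Qed.

Lemma poisson_continuous (l e : R) : 0 < e -> continuous (poisson l e).
Proof.
move=> e0 x; apply: cvgM; first exact: cvg_cst.
apply: cvgV; first by rewrite gt_eqF// poisson_denom_gt0.
apply: cvgD; last exact: cvg_cst.
rewrite /= expr2; under eq_fun do rewrite expr2.
by apply: cvgM; apply: cvgB => //; exact: cvg_cst.
Qed.

Section Sum.
Variables (n : nat) (l w : 'I_n -> R).
Hypothesis w_ge0 : forall j, 0 <= w j.

Definition poisson_sum (e x : R) : R := \sum_j w j * poisson (l j) e x.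

Lemma poisson_sum_ge0 e x : 0 < e -> 0 <= poisson_sum e x.
Proof. by move=> e0; apply: sumr_ge0 => j _; rewrite mulr_ge0// poisson_ge0. Qed.

Lemma poisson_sum_continuous e : 0 < e -> continuous (poisson_sum e).
Proof.
move=> e0 x; apply: cvg_big => [z|j _]; first exact: add_continuous.
by apply: cvgM; [exact: cvg_cst|exact: poisson_continuous].
Qed.

Lemma poisson_sum_level_closed e t : 0 < e -> closed [set x | t <= poisson_sum e x].
Proof.
move=> e0; have -> : [set x | t <= poisson_sum e x] =
  poisson_sum e @^-1` [set y | t <= y] by [].
apply: preimage_closed; last exact: closed_ge.
by move=> x _; exact: poisson_sum_continuous.
Qed.

Lemma is_derive_poisson (c e x : R) : 0 < e ->
  is_derive x 1 (fun x => atan ((x - c) / e)) (poisson c e x).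
Proof.
move=> e0.
have h : is_derive x 1 (fun x : R => (x - c) / e) e^-1.
  apply: is_derive_eq; rewrite /= ?scaler0 ?subr0 ?add0r ?mulr1.
  by rewrite scaler1 ?add0r ?oppr0 ?addr0.
have := @is_derive1_comp _ atan (fun x : R => (x - c) / e) x _ _ (is_derive1_atan _) h.
move=> hd; apply: (is_derive_eq hd).
rewrite /poisson.
have := poisson_denom_gt0 c x e0 => d0.
have e1 : e != 0 by rewrite gt_eqF.
have d1 : (c - x) ^+ 2 + e ^+ 2 != 0 by rewrite gt_eqF.
rewrite exprMn exprVn; field.
by rewrite d1 e1.
Qed.

(** Each kernel has the antiderivative [atan ((x - l_j) / e)], whose increments are at most [pi]
    whatever [e] and [T] are. *)
Lemma poisson_sum_integral (e T : R) : 0 < e -> 0 < T ->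
  (\int[mu]_(x in `[(- T)%R, T]) (poisson_sum e x)%:E <= (pi * \sum_j w j)%:E)%E.
Proof.
move=> e0 T0; pose F (x : R) := \sum_j w j * atan ((x - l j) / e).
have dF (x : R) : is_derive x 1 F (poisson_sum e x).
  have -> : F = \sum_j (fun x => w j * atan ((x - l j) / e)).
    by apply/funext => y; rewrite fct_sumE.
  apply: is_derive_sum => j; have h := @is_derive_poisson (l j) e x e0.
  exact: (@is_deriveZ _ _ _ _ (w j) _ _ _ h).
have cF : continuous F.
  by move=> x; apply/differentiable_continuous/derivable1_diffP; have [] := dF x.
rewrite (@continuous_FTC2 _ _ F).
- rewrite -EFinB lee_fin /F -sumrB mulr_sumr ler_sum// => j _.
  rewrite -mulrBr mulrC ler_wpM2r//.
  have := atan_ltpi2 ((T - l j) / e); have := atan_gtNpi2 ((- T - l j) / e).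
  lra.
- lra.
- by apply: continuous_subspaceT; exact: poisson_sum_continuous.
- split; first by move=> x _; have [] := dF x.
  + exact/cvg_at_right_filter/cF.
  + exact/cvg_at_left_filter/cF.
- by move=> x _; rewrite derive1E; have [_ ->] := dF x.
Qed.

Lemma poisson_sum_weak_type (e t T : R) : 0 < e -> 0 < T -> 0 < t ->
  (mu (`[(- T)%R, T] `&` [set x | (t <= poisson_sum e x)%R]) <= (pi * (\sum_j w j) / t)%:E)%E.
Proof.
move=> e0 T0 t0; set Z := _ `&` _.
have mZ : measurable Z.
  apply: measurableI => //.
  by apply: closed_measurable; apply: poisson_sum_level_closed.
have mf : measurable_fun setT (EFin \o poisson_sum e).
  have := continuous_measurable_fun (poisson_sum_continuous e0).
  by move/measurable_EFinP.
suff : (t%:E * mu Z <= (pi * \sum_j w j)%:E)%E.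
  by rewrite [in X in _ -> X]EFinM lee_pdivlMr// muleC.
apply: le_trans (poisson_sum_integral e0 T0).
rewrite -(@integral_cst _ _ R mu)//.
apply: (@le_trans _ _ (\int[mu]_(x in Z) (poisson_sum e x)%:E)%E).
  apply: ge0_le_integral => //.
  - by move=> x _; rewrite lee_fin ltW.
  - exact: measurable_funS mf.
  - by move=> x [_ /=]; rewrite lee_fin.
apply: ge0_subset_integral => //.
- exact: measurable_funS mf.
- by move=> x _; rewrite lee_fin poisson_sum_ge0.
- exact: subIsetl.
Qed.

End Sum.
End Poisson.

(** * Truncations of the Jacobi matrix *)

Lemma poly_lipschitz_bounded (R : realFieldType) (p : {poly R}) (B : R) : 0 <= B ->
  exists K L : R, [/\ 0 <= K, 0 <= L, forall x, `|x| <= B -> `|p.[x]| <= K &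
    forall x y, `|x| <= B -> `|y| <= B -> `|p.[x] - p.[y]| <= L * `|x - y|].
Proof.
move=> B0; elim/poly_ind: p => [|p c [K [L [K0 L0 hK hL]]]].
  exists 0, 0; split => // [x|x y] *; first by rewrite horner0 normr0.
  by rewrite !horner0 subrr normr0 mul0r.
exists (K * B + `|c|), (L * B + K); split.
- by rewrite addr_ge0// mulr_ge0.
- by rewrite addr_ge0// mulr_ge0.
- move=> x xB; rewrite hornerMXaddC (le_trans (ler_normD _ _))// lerD2r normrM.
  by rewrite ler_pM// hK.
move=> x y xB yB; rewrite !hornerMXaddC.
have -> : p.[x] * x + c - (p.[y] * y + c) = (p.[x] - p.[y]) * x + p.[y] * (x - y) by ring.
rewrite (le_trans (ler_normD _ _))// !normrM mulrDl lerD//.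
  by rewrite mulrAC ler_pM// hL.
by rewrite ler_wpM2r// hK.
Qed.

Section SpectralFamily.
Context {R : realType} (a b : nat -> R) (c C : R).
Hypothesis c_gt0 : 0 < c.
Hypothesis a_bound : forall n, (1 <= n)%N -> c <= a n <= C.
Hypothesis b_bound : forall n, (1 <= n)%N -> - C <= b n <= C.
Notation p := (opoly a b).

Let a_gt0 n : (1 <= n)%N -> 0 < a n.
Proof. by move=> /a_bound/andP[h _]; exact: lt_le_trans h. Qed.

Let a_neq0 n : (1 <= n)%N -> a n != 0.
Proof. by move=> /a_gt0 h; rewrite gt_eqF. Qed.



(** The eigenvalues of the truncation, as one function of [n]. For [n >= 1] the default value is
    never reached, by [opoly_roots]. *)
Definition gauss_node n : 'I_n -> R :=
  xget (fun=> 0) [set l : 'I_n -> R | injective l /\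
    p n.+1 = (\prod_(1 <= j < n.+1) (a j)^-1) *: \prod_(i < n) ('X - (l i)%:P)].
Arguments gauss_node : clear implicits.

Lemma gauss_nodeP n : (1 <= n)%N -> injective (gauss_node n) /\
  p n.+1 = (\prod_(1 <= j < n.+1) (a j)^-1) *: \prod_(i < n) ('X - (gauss_node n i)%:P).
Proof.
move=> n1; rewrite /gauss_node; case: xgetP => [l _ //|h].
by have [l l1 l2] := opoly_roots b a_neq0 n1; have := h l; case; split.
Qed.

Lemma gauss_node_inj n : (1 <= n)%N -> injective (gauss_node n).
Proof. by move=> /gauss_nodeP[]. Qed.

Lemma gauss_node_root n i : (1 <= n)%N -> (p n.+1).[gauss_node n i] = 0.
Proof.
move=> /gauss_nodeP[_ ->]; rewrite hornerZ horner_prod (bigD1 i)//= hornerXsubC.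
by rewrite subrr mul0r mulr0.
Qed.

(** Both sides are the modulus of the characteristic polynomial of the truncation. *)
Lemma opoly_horner n x : (1 <= n)%N ->
  \prod_j `|x - gauss_node n j| = (\prod_(1 <= j < n.+1) a j) * `|(p n.+1).[x]|.
Proof.
move=> n1; have [_ ->] := gauss_nodeP n1.
rewrite hornerZ normrM ger0_norm.
  have e1 : (\prod_(1 <= j < n.+1) a j) * \prod_(1 <= j < n.+1) (a j)^-1 = 1.
    rewrite -big_split/= big_nat big1// => j /andP[j1 _].
    by rewrite mulfV// a_neq0.
  by rewrite mulrA e1 mul1r horner_prod normr_prod; apply: eq_bigr => j _; rewrite hornerXsubC.
by rewrite big_nat prodr_ge0// => j /andP[j1 _]; rewrite invr_ge0 ltW// a_gt0.
Qed.

Definition gauss_weight n j := christoffel a b n (gauss_node n j).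

Lemma gauss_weight_ge0 n j : (1 <= n)%N -> 0 <= gauss_weight (n := n) j.
Proof. by move=> n1; exact/ltW/christoffel_gt0. Qed.

(** The diagonal case of [opoly_col_orthonormal]. For [i = 1] it says that the weights sum to 1. *)
Lemma sum_gauss_weight n i : (1 <= i <= n)%N ->
  \sum_j @gauss_weight n j * (p i).[gauss_node n j] ^+ 2 = 1.
Proof.
move=> /[dup] hi /andP[i1 iN]; have n1 : (1 <= n)%N := leq_trans i1 iN.
have root j : (p n.+1).[gauss_node n j] = 0 by exact: gauss_node_root.
have := opoly_col_orthonormal a_neq0 n1 (gauss_node_inj n1) root hi hi.
rewrite eqxx => /esym/esym h; rewrite -[RHS]h.
by apply: eq_bigr => j _; rewrite expr2.
Qed.

(** No [b_i] lies beyond [C] in absolute value, so by [weyl_card] no eigenvalue lies more than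
    [2 * C] further out; [s = 1] and [s = -1] treat the two ends. *)
Lemma gauss_node_bound n j : (1 <= n)%N -> `|gauss_node n j| <= 3 * C.
Proof.
move=> n1.
have h (s : R) : `|s| = 1 -> s * gauss_node n j <= 3 * C.
  move=> s1; rewrite leNgt; apply/negP => hs.
  have root k : (p n.+1).[gauss_node n k] = 0 by exact: gauss_node_root.
  have a_ge0 i : (1 <= i)%N -> 0 <= a i by move=> ?; exact/ltW/a_gt0.
  have a_le i : (1 <= i)%N -> a i <= C by move=> /a_bound/andP[].
  have s1' : `|s| <= 1 by rewrite s1.
  have := weyl_card a_neq0 n1 (gauss_node_inj n1) root a_ge0 a_le (s * C) s1'.
  apply/negP; rewrite -ltnNge.
  rewrite (@leq_trans 1)//; last first.
    apply/card_gt0P; exists j; rewrite inE mulrBr mulrA -expr2.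
    have -> : s ^+ 2 = 1 by rewrite -real_normK ?num_real// s1 expr1n.
    by move: hs; lra.
  rewrite ltnS leqn0 cards_eq0; apply/eqP/setP => i; rewrite !inE.
  apply/negbTE; rewrite -leNgt mulrBr mulrA -expr2.
  have -> : s ^+ 2 = 1 by rewrite -real_normK ?num_real// s1 expr1n.
  rewrite mul1r subr_le0 (le_trans (ler_norm _))// normrM s1 mul1r ler_norml.
  exact: b_bound.
rewrite ler_norml; have := h 1; have := h (-1).
by rewrite normrN normr1 => /(_ erefl) ? /(_ erefl) ?; lra.
Qed.

(** The imaginary part of the first diagonal entry of [(J_n - E - i e)^-1]. *)
Definition truncated_im n (e E : R) : R := poisson_sum (gauss_node n) (@gauss_weight n) e E.

(** Here [u + i v] solves the resolvent equation for [delta_1]. Cutting it at [n] leaves one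
    boundary term, which perturbs the Poisson kernel at each node; averaging over the nodes gives
    the error. *)
Lemma truncated_im_approx (u v : nat -> R) (e E : R) n : (1 <= n)%N -> 0 < e ->
  u 0%N = 0 -> v 0%N = 0 ->
  (forall i, (1 <= i)%N -> a i.-1 * u i.-1 + a i * u i.+1 + b i * u i - E * u i + e * v i
     = (i == 1%N)%:R) ->
  (forall i, (1 <= i)%N -> a i.-1 * v i.-1 + a i * v i.+1 + b i * v i - E * v i - e * u i = 0) ->
  `|v 1%N - truncated_im n e E| <= C / e * (`|u n.+1| + `|v n.+1|).
Proof.
move=> n1 e0 u0 v0 hu hv.
pose l := gauss_node n; pose w := @gauss_weight n.
pose U := fourier a b l u; pose V := fourier a b l v.
have pl i : (p n.+1).[l i] = 0 by exact: gauss_node_root.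
have tt j : three_term a b (l j) (fun i => (p i).[l j]).
  move=> i i1; have := opoly_three_term b a_neq0 idfun (l j) i1.
  by rewrite /= !map_poly_id.
have eU j : l j * U j + a n * ((p n).[l j] * u n.+1) - E * U j + e * V j = 1.
  have := @green_identity _ a b (fun i => (p i).[l j]) u (l j) n (horner0 _) u0 (tt j).
  rewrite /= pl mul0r subr0 -/(fourier a b l u j) -/(U j) => <-.
  rewrite /U /V /fourier !mulr_sumr -sumrB -big_split/=.
  rewrite big_ltn// big_nat big1 ?addr0.
    have h := hu 1%N isT; rewrite eqxx in h.
    by rewrite -[RHS]h (_ : p 1 = 1)// hornerC; ring.
  move=> i /andP[i2 _]; have := hu i (ltnW i2); rewrite gtn_eqF// => h.
  transitivity ((p i).[l j] * false%:R); last by rewrite mulr0.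
  by rewrite -h; ring.
have eV j : l j * V j + a n * ((p n).[l j] * v n.+1) - E * V j - e * U j = 0.
  have := @green_identity _ a b (fun i => (p i).[l j]) v (l j) n (horner0 _) v0 (tt j).
  rewrite /= pl mul0r subr0 -/(fourier a b l v j) -/(V j) => <-.
  rewrite /U /V /fourier !mulr_sumr -!sumrB big_nat big1// => i /andP[i1 _].
  transitivity ((p i).[l j] * 0); last by rewrite mulr0.
  by rewrite -(hv i i1); ring.
have v1E : v 1%N = \sum_j w j * V j.
  transitivity (\sum_(1 <= i < n.+1) v i * (i == 1%N)%:R).
    rewrite big_ltn// eqxx mulr1 big_nat big1 ?addr0// => i /andP[i2 _].
    by rewrite gtn_eqF// mulr0.
  have := parseval a_neq0 n1 (gauss_node_inj n1) pl v (fun i => (i == 1%N)%:R).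
  move=> <-; apply: eq_bigr => j _; congr (_ * _).
  rewrite -[RHS]mulr1; congr (_ * _).
  rewrite /fourier big_ltn// eqxx mulr1 (_ : p 1 = 1)// hornerC.
  by rewrite big_nat big1 ?addr0// => i /andP[i2 _]; rewrite gtn_eqF// mulr0.
pose D j := (l j - E) ^+ 2 + e ^+ 2.
have D0 j : 0 < D j by exact: poisson_denom_gt0.
(* Eliminate [U j] from the linear system formed by [eU] and [eV]. *)
have Vj j : V j - poisson (l j) e E =
    - (a n * (p n).[l j] * (e * u n.+1 + (l j - E) * v n.+1)) / D j.
  have h1 : V j * D j = e - a n * (p n).[l j] * (e * u n.+1 + (l j - E) * v n.+1).
    rewrite /D; transitivity (e * (l j * U j + a n * ((p n).[l j] * u n.+1) - E * U j + e * V j)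
      + (l j - E) * (l j * V j + a n * ((p n).[l j] * v n.+1) - E * V j - e * U j)
      - a n * (p n).[l j] * (e * u n.+1 + (l j - E) * v n.+1)); first by ring.
    by rewrite eU eV mulr1 mulr0 addr0.
  have -> : V j = V j * D j / D j by rewrite mulfK// gt_eqF.
  by rewrite h1 /poisson -/(D j); field; rewrite gt_eqF.
rewrite v1E /truncated_im /poisson_sum -sumrB.
under eq_bigr => j _ do rewrite -mulrBr Vj.
rewrite (le_trans (ler_norm_sum _ _ _))//.
set K := _ + _.
have K0 : 0 <= K by rewrite addr_ge0.
(* Bounding [|p_n|] by [(1 + p_n^2) / 2] is useful because 1 and [p_n^2] both have weighted sum 1.
   The quotient by [D j] is at most [K / e], since [e^2] and [e * |l_j - E|] are at most [D j]. *)
have le1 j : `|w j * (- (a n * (p n).[l j] * (e * u n.+1 + (l j - E) * v n.+1)) / D j)| <=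
    C / e * K * ((w j + w j * (p n).[l j] ^+ 2) / 2).
  have w0 : 0 <= w j by exact: gauss_weight_ge0.
  rewrite normrM [X in X * _]ger0_norm//.
  have -> : C / e * K * ((w j + w j * (p n).[l j] ^+ 2) / 2) =
    w j * (C * ((1 + (p n).[l j] ^+ 2) / 2) * (K / e)) by field; rewrite gt_eqF.
  rewrite ler_wpM2l// normrM normrN [X in X * _]normrM -mulrA ler_pM//.
    rewrite normrM ler_pM//.
      by have /andP[_ ] := a_bound n1; rewrite ger0_norm// ltW// a_gt0.
    rewrite -[(p n).[l j] ^+ 2]real_normK ?num_real//.
    have := sqr_ge0 (1 - `|(p n).[l j]|); lra.
  rewrite normfV (gtr0_norm (D0 j)) ler_pdivrMr// mulrAC ler_pdivlMr//.
  rewrite (le_trans (ler_wpM2r (ltW e0) (ler_normD _ _)))// !normrM (ger0_norm (ltW e0)).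
  rewrite /K mulrDl [leRHS]mulrDl lerD//.
    rewrite mulrAC mulrC ler_wpM2l// /D -expr2 lerDr sqr_ge0//.
  rewrite mulrAC mulrC ler_wpM2l// /D -(real_normK (num_real (l j - E))).
  have := sqr_ge0 (`|l j - E| - e); have := sqr_ge0 (`|l j - E| + e); nra.
rewrite (le_trans (ler_sum _ (fun j _ => le1 j)))// -mulr_sumr -mulr_suml big_split/=.
rewrite (sum_gauss_weight (i := n)) ?n1 ?leqnn//.
have -> : \sum_j w j = 1.
  rewrite -(@sum_gauss_weight n 1) ?n1//; apply: eq_bigr => j _.
  by rewrite (_ : p 1 = 1)// hornerC expr1n mulr1.
by rewrite divff ?mulr1 ?pnatr_eq0//.
Qed.

Lemma truncated_im_ge0 n e E : (1 <= n)%N -> 0 < e -> 0 <= truncated_im n e E.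
Proof. by move=> n1 e0; apply: poisson_sum_ge0 => // j; exact: gauss_weight_ge0. Qed.

End SpectralFamily.

(** * The absolutely continuous spectrum *)

Section AcLevel.
Context {R : realType} (a b : nat -> R) (c C : R).
Hypothesis c_gt0 : 0 < c.
Hypothesis a_bound : forall n, (1 <= n)%N -> c <= a n <= C.
Hypothesis b_bound : forall n, (1 <= n)%N -> - C <= b n <= C.
Notation p := (opoly a b).
Notation mu := (@lebesgue_measure R).
Notation F := (truncated_im a b).

Lemma l2_delta1 (psi : nat -> R[i]) : complex.Im (l2_inner (@delta1 R) psi) = complex.Im (psi 1%N).
Proof.
rewrite /l2_inner /=; apply: cvg_lim => //; apply: cvg_near_cst.
exists 2%N => // n /= n2; rewrite /series/= big_ltn ?(ltn_trans _ n2)//.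
rewrite big_ltn// big_nat big1 ?addr0 => [|i /andP[i2 _]].
  rewrite /delta1 /=; case: (psi 0%N) (psi 1%N) => [x y] [x' y'] /=.
  by rewrite !oppr0 !(mul0r, mul1r, add0r, addr0).
rewrite /delta1 gtn_eqF//=; case: (psi i) => [x y] /=.
by rewrite !oppr0 !(mul0r, add0r).
Qed.

Lemma l2_inner0 (phi : nat -> R[i]) : complex.Im (l2_inner phi (fun=> 0)) = 0.
Proof.
rewrite /l2_inner /=; apply: cvg_lim => //; apply: cvg_near_cst.
by apply: nearW => n; rewrite /series/= big1// => i _; rewrite mulr0.
Qed.

Lemma re_tridiag (al be ga E e : R) (x y z : R[i]) :
  complex.Re (real_complex R al * x + real_complex R be * y + real_complex R ga * z
    - Complex E e * z) =
  al * complex.Re x + be * complex.Re y + ga * complex.Re z - E * complex.Re z + e * complex.Im z.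
Proof. by case: x y z => [x x'] [y y'] [z z'] /=; ring. Qed.

Lemma im_tridiag (al be ga E e : R) (x y z : R[i]) :
  complex.Im (real_complex R al * x + real_complex R be * y + real_complex R ga * z
    - Complex E e * z) =
  al * complex.Im x + be * complex.Im y + ga * complex.Im z - E * complex.Im z - e * complex.Re z.
Proof. by case: x y z => [x x'] [y y'] [z z'] /=; ring. Qed.

Lemma l2_entry_small (psi : nat -> R[i]) (d : R) : l2 psi -> 0 < d ->
  exists N0, forall N, (N0 <= N)%N -> `|complex.Re (psi N)| + `|complex.Im (psi N)| <= d.
Proof.
move=> [_ /cvg_series_cvg_0 /cvgrPdist_lt h] d0.
have [N0 _ hN] := h ((d / 2) ^+ 2) (exprn_gt0 _ (divr_gt0 d0 (ltr0n R 2))).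
exists N0 => N /hN /=; rewrite sub0r normrN ger0_norm ?sqr_ge0//.
case: (psi N) => [x y] /=; rewrite sqr_sqrtr ?addr_ge0 ?sqr_ge0// => hxy.
have xd : `|x| <= d / 2.
  rewrite -(@ler_pXn2r _ 2)// ?nnegrE ?divr_ge0 ?(ltW d0)//.
  by rewrite real_normK ?num_real//; have := sqr_ge0 y; lra.
have yd : `|y| <= d / 2.
  rewrite -(@ler_pXn2r _ 2)// ?nnegrE ?divr_ge0 ?(ltW d0)//.
  by rewrite real_normK ?num_real//; have := sqr_ge0 x; lra.
lra.
Qed.

(* If no solution in [l2] existed, the resolvent would be the default value [0]. *)
Lemma truncated_im_cvg (E e d : R) : 0 < e -> 0 < d ->
  complex.Im (green11 a b (Complex E e)) != 0 ->
  exists N0, forall N, (N0 <= N)%N ->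
    `|complex.Im (green11 a b (Complex E e)) - F N e E| <= d.
Proof.
move=> e0 d0; rewrite /green11 /resolvent; case: xgetP => [psi _ [psi2 hpsi]|_]; last first.
  by rewrite l2_inner0 eqxx.
move=> _; rewrite l2_delta1.
have eqn i : real_complex R (if i is 0 then 1 else a i) * psi i
    + real_complex R (a i.+1) * psi i.+2 + real_complex R (b i.+1) * psi i.+1
    - Complex E e * psi i.+1 = (i.+1 == 1%N)%:R by rewrite -[RHS](congr1 (fun f => f i.+1) hpsi).
have psi0 : psi 0%N = 0 by case: psi2.
pose u n := complex.Re (psi n); pose v n := complex.Im (psi n).
have u0 : u 0%N = 0 by rewrite /u psi0.
have v0 : v 0%N = 0 by rewrite /v psi0.
have hu i : (1 <= i)%N ->
    a i.-1 * u i.-1 + a i * u i.+1 + b i * u i - E * u i + e * v i = (i == 1%N)%:R.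
  case: i => // i _ /=; have := congr1 (@complex.Re R) (eqn i); rewrite re_tridiag.
  rewrite -/(u i) -/(u i.+1) -/(u i.+2) -/(v i.+1).
  (* At site 1 the operator has the coefficient 1 instead of [a 0]; both multiply [psi 0 = 0]. *)
  by case: i => [|i] h; [rewrite u0 !mulr0 in h *|]; exact: h.
have hv i : (1 <= i)%N ->
    a i.-1 * v i.-1 + a i * v i.+1 + b i * v i - E * v i - e * u i = 0.
  case: i => // i _ /=; have := congr1 (@complex.Im R) (eqn i); rewrite im_tridiag.
  rewrite -/(v i) -/(v i.+1) -/(v i.+2) -/(u i.+1).
  by case: i => [|i] h; [rewrite v0 !mulr0 in h *|]; exact: h.
have C0 : 0 < C.
  by have /andP[h1 h2] := a_bound (leqnn 1); exact: lt_le_trans c_gt0 (le_trans h1 h2).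
have [N0 hN0] := l2_entry_small psi2 (divr_gt0 d0 (divr_gt0 C0 e0)).
exists (maxn 1 N0) => N; rewrite geq_max => /andP[N1 N0N].
apply: (le_trans (truncated_im_approx c_gt0 a_bound N1 e0 u0 v0 hu hv)).
by rewrite mulrC -ler_pdivlMr ?divr_gt0// hN0// leqW.
Qed.

(* [N0 + N] is the size of the truncation and [1 / (k + m + 1)] the imaginary part. *)
Definition ac_level (k : nat) : set R :=
  \bigcap_m \bigcup_N0 \bigcap_N
    [set E | k.+1%:R^-1 <= F (N0 + N)%N (k + m).+1%:R^-1 E].

Lemma ac_level_measurable k : measurable (ac_level k).
Proof.
apply: bigcapT_measurable => m; apply: bigcupT_measurable => N0.
apply: bigcapT_measurable => N; apply: closed_measurable.
by apply: poisson_sum_level_closed; rewrite invr_gt0.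
Qed.

Lemma ac_level_mono : nondecreasing_seq ac_level.
Proof.
move=> k k' kk'; apply/subsetPset => E hE m _.
(* Index [k' - k + m] at level [k] uses the same imaginary part as index [m] at level [k']. *)
have [N0 _ h] := hE (k' - k + m)%N I; exists N0 => // N _.
have := h N I; rewrite /= addnA subnKC//; apply: le_trans.
by rewrite lef_pV2 ?posrE// ler_nat.
Qed.

(** For small [e] the modulus of [Im G] exceeds [|l| / 2], and its sign is that of the nonnegative
    truncations. These come within [|l| / 4] of it, hence stay above [|l| / 4], and [k] is taken
    with [1 / (k + 1) <= |l| / 4]. *)
Lemma Sigma_ac_sub_level : Sigma_ac a b `<=` \bigcup_k ac_level k.
Proof.
move=> E [l l0 /cvgrPdist_lt hl].
have l2 : 0 < `|l| / 2 by rewrite divr_gt0// normr_gt0.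
have [d /= d0 hd] := hl _ l2.
have large e : 0 < e -> e < d -> `|l| / 2 <= complex.Im (green11 a b (Complex E e)).
  move=> e0 ed; have he : `|l - complex.Im (green11 a b (Complex E e))| < `|l| / 2.
    by apply: hd => //; rewrite /= sub0r normrN gtr0_norm.
  set g := complex.Im _ in he *.
  have g2 : `|l| / 2 < `|g| by have := lerB_dist l g; lra.
  suff g0 : 0 <= g by move: g2; rewrite (ger0_norm g0) => /ltW.
  have gn0 : g != 0 by rewrite -normr_gt0; lra.
  rewrite leNgt; apply/negP => gneg.
  have g20 : 0 < - g / 2 by lra.
  have [N0 hN] := truncated_im_cvg e0 g20 gn0.
  have := hN (maxn 1 N0) (leq_maxr _ _); rewrite -/g.
  have := truncated_im_ge0 a b E (leq_maxl 1 N0) e0.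
  by rewrite ler_norml; lra.
have [k kd] : exists k : nat, k.+1%:R^-1 < d /\ k.+1%:R^-1 <= `|l| / 4.
  have m0 : 0 < Num.min d (`|l| / 4) by rewrite lt_min d0 divr_gt0// normr_gt0.
  pose k := Num.truncn (Num.min d (`|l| / 4))^-1; exists k.
  have hk : k.+1%:R^-1 < Num.min d (`|l| / 4).
    by rewrite invf_plt ?posrE// truncnS_gt.
  by move: hk; rewrite lt_min => /andP[? ?]; split => //; exact: ltW.
exists k => // m _; pose e : R := (k + m).+1%:R^-1.
have e0 : 0 < e by rewrite invr_gt0.
have ed : e < d.
  apply: le_lt_trans kd.1; rewrite lef_pV2 ?posrE// ler_nat ltnS leq_addr//.
have hG := large e e0 ed.
have l4 : 0 < `|l| / 4 by rewrite divr_gt0// normr_gt0.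
have G0 : complex.Im (green11 a b (Complex E e)) != 0 by rewrite gt_eqF//; lra.
have [N0 hN] := truncated_im_cvg e0 l4 G0.
exists N0 => // N _ /=; have := hN (N0 + N)%N (leq_addr _ _).
rewrite -/e ler_norml => /andP[_ hF]; have kl := kd.2.
set G := complex.Im _ in hG hF; set FF := F _ _ _ in hF *; clearbody G FF.
by move: hG hF kl; move: (k.+1%:R^-1) (`|l|) => x y; lra.
Qed.

(** Moves [p_n^2] from [E] to the nodes under the Poisson integral. The Lipschitz error is absorbed
    by [(x - E)^2 * poisson x e E <= e], and [L] is uniform in [N] because all nodes lie in
    [[-3C, 3C]]. *)
Lemma opoly_sqr_truncated_im n (T : R) : (1 <= n)%N -> 0 <= T ->
  exists2 L : R, 0 <= L & forall N e E, (n <= N)%N -> 0 < e -> `|E| <= T ->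
    (p n).[E] ^+ 2 * F N e E <=
    2 * poisson_sum (gauss_node a b (n := N))
      (fun j => gauss_weight a b j * (p n).[gauss_node a b j] ^+ 2) e E + L * e.
Proof.
move=> n1 T0; have B0 : 0 <= Num.max (3 * C) T by rewrite le_max T0 orbT.
have [K [L [_ L0 _ hL]]] := poly_lipschitz_bounded (p n) B0.
exists (2 * L ^+ 2); first by rewrite mulr_ge0// sqr_ge0.
move=> N e E nN e0 ET; have N1 := leq_trans n1 nN.
have sw : \sum_j @gauss_weight R a b N j = 1.
  rewrite -(@sum_gauss_weight R a b c C c_gt0 a_bound N 1) ?N1//.
  by apply: eq_bigr => j _; rewrite (_ : p 1 = 1)// hornerC expr1n mulr1.
have Le : 2 * L ^+ 2 * e = \sum_j 2 * L ^+ 2 * e * @gauss_weight R a b N j.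
  by rewrite -mulr_sumr sw mulr1.
rewrite /truncated_im /poisson_sum !mulr_sumr Le -big_split/=.
apply: ler_sum => j _; set w := gauss_weight a b j; set x := gauss_node a b j.
have w0 : 0 <= w by exact: gauss_weight_ge0.
have -> : (p n).[E] ^+ 2 * (w * poisson x e E) = w * ((p n).[E] ^+ 2 * poisson x e E) by ring.
have -> : 2 * (w * (p n).[x] ^+ 2 * poisson x e E) + 2 * L ^+ 2 * e * w =
  w * (2 * (p n).[x] ^+ 2 * poisson x e E + 2 * L ^+ 2 * e) by ring.
rewrite ler_wpM2l//.
have P0 : 0 <= poisson x e E by exact: poisson_ge0.
have h1 : (p n).[E] ^+ 2 <= 2 * (p n).[x] ^+ 2 + 2 * L ^+ 2 * (x - E) ^+ 2.
  have : ((p n).[x] - (p n).[E]) ^+ 2 <= (L * `|x - E|) ^+ 2.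
    rewrite -[leLHS]real_normK ?num_real// ler_pXn2r ?nnegrE ?mulr_ge0//.
    apply: hL; rewrite le_max; last by rewrite ET orbT.
    by rewrite (gauss_node_bound c_gt0 a_bound b_bound).
  rewrite exprMn real_normK ?num_real//.
  have := sqr_ge0 (2 * (p n).[x] - (p n).[E]); nra.
have h2 : (x - E) ^+ 2 * poisson x e E <= e.
  rewrite /poisson mulrA ler_pdivrMr ?poisson_denom_gt0// [leLHS]mulrC.
  by apply: ler_wpM2l; [exact: ltW|rewrite lerDl sqr_ge0].
apply: (le_trans (ler_wpM2r P0 h1)); rewrite mulrDl lerD2l -[leLHS]mulrA.
by apply: ler_wpM2l => //; rewrite mulr_ge0// sqr_ge0.
Qed.

Lemma ac_level_opoly_large k n (T K : R) : (1 <= n)%N -> 0 < T -> 0 < K ->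
  (mu (ac_level k `&` `[(- T)%R, T] `&` [set E | (K <= `|(p n).[E]|)%R]) <=
    (4 * pi * k.+1%:R / K ^+ 2)%:E)%E.
Proof.
move=> n1 T0 K0; have [L L0 hL] := opoly_sqr_truncated_im n1 (ltW T0).
(* On the set in question [p_n^2 * F >= 4 * t]; once [L * e <= 2 * t], the Poisson integral of
   [p_n^2] is at least [t]. *)
pose t : R := K ^+ 2 / (4 * k.+1%:R).
have t0 : 0 < t by rewrite divr_gt0 ?exprn_gt0// mulr_gt0.
pose m := Num.truncn (L / (2 * t)).
pose e : R := (k + m).+1%:R^-1.
have e0 : 0 < e by rewrite invr_gt0.
have Le : L * e <= 2 * t.
  rewrite /e ler_pdivrMr// mulrC -ler_pdivrMr ?mulr_gt0//.
  rewrite (le_trans (ltW (truncnS_gt _)))// ler_nat ltnS leq_addl//.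
pose Q N E := poisson_sum (gauss_node a b (n := N))
      (fun j => gauss_weight a b j * (p n).[gauss_node a b j] ^+ 2) e E.
(* The size of the truncation includes [n], as [opoly_sqr_truncated_im] requires. These sets
   increase with [N0] and each lies in the level set of a single truncation, so their union inherits
   the uniform bound. *)
pose Z N0 : set R := `[(- T)%R, T] `&` \bigcap_N [set E | t <= Q (N0 + n + N)%N E].
have mZ N0 : measurable (Z N0).
  apply: measurableI => //; apply: bigcapT_measurable => N; apply: closed_measurable.
  exact: poisson_sum_level_closed.
apply: (@le_trans _ _ (mu (\bigcup_N Z N))).
  apply: le_outer_measure => E [[hE]]; rewrite /= in_itv/= -ler_norml => ET KE.
  have [N0 _ hN0] := hE m I; exists N0 => //; split; first by rewrite /= in_itv/= -ler_norml.
  move=> N _ /=; have := hN0 (n + N)%N I; rewrite /= -/e addnA => hF.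
  have := hL (N0 + n + N)%N e E; rewrite -/(Q _ _).
  rewrite -addnA addnCA leq_addr => /(_ isT e0 ET); rewrite addnCA addnA => hQ.
  have hp : K ^+ 2 <= (p n).[E] ^+ 2.
    by rewrite -[leRHS]real_normK ?num_real// ler_pXn2r ?nnegrE// ltW.
  have h4 : 4 * t <= (p n).[E] ^+ 2 * F (N0 + n + N) e E.
    have -> : 4 * t = K ^+ 2 * k.+1%:R^-1 by rewrite /t; field; rewrite ?natr1 ?nat1r pnatr_eq0.
    by rewrite ler_pM// ?sqr_ge0// invr_ge0.
  move: hQ h4 Le; lra.
apply: bigcup_measure_le => //.
  move=> N0 N0' le; apply/subsetPset => E [ET hE]; split => // N _.
  have := hE (N0' - N0 + N)%N I; rewrite /=.
  by rewrite addnAC addnA subnKC// addnAC.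
move=> N0.
have N1 : (1 <= N0 + n)%N by rewrite (leq_trans n1)// leq_addl.
apply: (@le_trans _ _ (mu (`[(- T)%R, T] `&` [set E | (t <= Q (N0 + n)%N E)%R]))).
  apply: le_outer_measure => E [ET hE]; split => //.
  by have := hE 0%N I; rewrite addn0.
apply: le_trans (poisson_sum_weak_type _ _ e0 T0 t0) _.
  by move=> j; rewrite mulr_ge0 ?sqr_ge0//; exact: gauss_weight_ge0.
rewrite (sum_gauss_weight b c_gt0 a_bound (n := N0 + n) (i := n)) ?n1 ?leq_addl//.
rewrite lee_fin mulr1 /t le_eqVlt; apply/orP; left; apply/eqP; field.
by rewrite ?natr1 ?nat1r pnatr_eq0 gt_eqF.
Qed.

End AcLevel.

(** * The main estimate *)

Section Edges.
Context {R : realType}.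
Implicit Types (EL ER : \bar R).

Definition edge_dist EL ER (x : R) : R := fine (Order.min `|x%:E - ER| `|x%:E - EL|)%E.

(** Such an [x] lies beyond a finite edge, and [edge_dist] is the distance to it. The first bound
    makes the factors of [D_n] at least [A_n], the second turns adding [d] into multiplication by a
    fixed factor, the third bounds eigenvalue factors from below at points [d] inside the window. *)
Lemma edge_dist_outside EL ER (x m A : R) : (EL < ER)%E -> 0 <= m -> 0 <= A ->
  ~~ (EL - m%:E - A%:E < x%:E < ER + m%:E + A%:E)%E ->
  [/\ A <= edge_dist EL ER x - m,
      edge_dist EL ER x <= `|fine EL| + `|fine ER| + `|x| &
      forall d E y : R, (EL + d%:E <= E%:E)%E -> (E%:E + d%:E <= ER)%E ->
        `|y - x| <= m -> edge_dist EL ER x - m + d <= `|E - y|].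
Proof.
move=> LR m0 A0; rewrite negb_and -!leNgt => /orP[xL|xR].
- case: EL LR xL => [el LR|LR|_]; [|by move: LR; rewrite ltNge leey|by move=> /=].
  rewrite -!EFinB lee_fin => xL.
  have -> : edge_dist el%:E ER x = el - x.
    rewrite /edge_dist minEle; case: ER LR => [er|_|]; last by rewrite ltNge leNye.
      rewrite lte_fin => lr; rewrite -!EFinB /= !ler0_norm; [|lra|lra].
      by case: ifP => /=; rewrite ?lee_fin; lra.
    have -> : (`|x%:E - +oo| <= `|x%:E - el%:E|)%E = false by rewrite /= ?leye_eq.
    by rewrite -EFinB /= ler0_norm; lra.
  split.
  + by lra.
  + have := ler_norm el; have := ler_norm (- x); rewrite normrN.
    by have := normr_ge0 (fine ER); lra.
  + move=> d E y; rewrite -EFinD lee_fin => dE _; rewrite ler_norml => /andP[_ yx].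
    by rewrite (le_trans _ (ler_norm _))//; lra.
- case: ER LR xR => [er LR|_|LR]; [|by move=> /=|by move: LR; rewrite ltNge leNye].
  rewrite -!EFinD lee_fin => xR.
  have -> : edge_dist EL er%:E x = x - er.
    rewrite /edge_dist minEle; case: EL LR => [el||_].
    - rewrite lte_fin => lr; rewrite -!EFinB /= !ger0_norm; [|lra|lra].
      by case: ifP => /=; rewrite ?lee_fin; lra.
    - by rewrite ltNge leey.
    - have -> : (`|x%:E - er%:E| <= `|x%:E - -oo|)%E by rewrite /= ?leey.
      by rewrite -EFinB /= ger0_norm; lra.
  split.
  + by lra.
  + have := ler_norm (- er); have := ler_norm x; rewrite normrN.
    by have := normr_ge0 (fine EL); lra.
  + move=> d E y _; rewrite -EFinD lee_fin => dE; rewrite ler_norml => /andP[yx _].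
    by rewrite distrC (le_trans _ (ler_norm _))//; lra.
Qed.

Definition inner_window EL ER (d : R) : set R :=
  [set E | (EL + d%:E <= E%:E)%E /\ (E%:E + d%:E <= ER)%E].

Lemma inner_window_measurable EL ER d : measurable (inner_window EL ER d).
Proof.
have -> : inner_window EL ER d =
   [set E | (EL + d%:E <= E%:E)%E] `&` [set E | (E%:E + d%:E <= ER)%E] by [].
apply: measurableI; apply: closed_measurable.
  case: EL => [el||].
  - by under eq_set do rewrite -EFinD lee_fin; exact: closed_ge.
  - rewrite (_ : [set _ | _] = set0); first exact: closed0.
    by apply/seteqP; split => // E /=; rewrite leNgt ltry.
  - rewrite (_ : [set _ | _] = setT); first exact: closedT.
    by apply/seteqP; split => // E _ /=; rewrite leNye.
case: ER => [er||].
- by under eq_set do rewrite -EFinD lee_fin -lerBrDr; exact: closed_le.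
- rewrite (_ : [set _ | _] = setT); first exact: closedT.
  by apply/seteqP; split => // E _ /=; rewrite leey.
- rewrite (_ : [set _ | _] = set0); first exact: closed0.
  by apply/seteqP; split => // E /=; rewrite leNgt ltNyr.
Qed.

Lemma inner_window_mono EL ER (d d' : R) : d' <= d ->
  inner_window EL ER d `<=` inner_window EL ER d'.
Proof.
move=> dd E [h1 h2]; split.
  by apply: le_trans h1; rewrite leeD2l// lee_fin.
by apply: le_trans h2; rewrite leeD2l// lee_fin.
Qed.

Lemma inner_window_cover EL ER (E : R) : (EL < E%:E < ER)%E ->
  exists2 d : R, 0 < d & inner_window EL ER d E.
Proof.
move=> /andP[hL hR].
have [d1 d10 h1] : exists2 d : R, 0 < d & (EL + d%:E <= E%:E)%E.
  case: EL hL => [el||]//.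
    by rewrite lte_fin => h; exists (E - el); rewrite ?subr_gt0// -EFinD lee_fin; lra.
  by move=> _; exists 1 => //=; rewrite leNye.
have [d2 d20 h2] : exists2 d : R, 0 < d & (E%:E + d%:E <= ER)%E.
  case: ER hR => [er||]//.
    by rewrite lte_fin => h; exists (er - E); rewrite ?subr_gt0// -EFinD lee_fin; lra.
  by move=> _; exists 1 => //=; rewrite leey.
exists (Num.min d1 d2); first by rewrite lt_min d10.
split.
  by apply: le_trans h1; rewrite leeD2l// lee_fin ge_min lexx.
by apply: le_trans h2; rewrite leeD2l// lee_fin ge_min lexx orbT.
Qed.

End Edges.

(** Both bases are at least [1 + th], and Bernoulli's inequality handles its [n]-th power.
    Uniformity in [N] matters because [N] will be [#I_n], over which there is no control. *)
Lemma two_rate_growth (R : realType) (K eps kap : R) : 0 < eps -> 0 < kap ->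
  exists n0, forall n N, (n0 <= n)%N -> (N <= n)%N ->
    K < (1 + eps) ^+ N * (1 + kap) ^+ (n - N).
Proof.
move=> e0 k0; pose th := Num.min eps kap.
have th0 : 0 < th by rewrite lt_min e0.
exists (Num.truncn (K / th)).+1 => n N n0n Nn.
apply: (@lt_le_trans _ _ ((1 + th) ^+ n)).
  apply: (@lt_le_trans _ _ (n%:R * th)).
    by rewrite -ltr_pdivrMr// (lt_le_trans (truncnS_gt _))// ler_nat.
  have bern : forall k, k%:R * th <= (1 + th) ^+ k.
    suff h : forall k, 1 + k%:R * th <= (1 + th) ^+ k.
      by move=> k; apply: le_trans (h k); rewrite lerDr.
    elim=> [|k IH]; first by rewrite mul0r addr0 expr0.
    rewrite exprSr -natr1 mulrDl mul1r.
    have h2 : 0 <= 1 + th by lra.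
    apply: le_trans (ler_wpM2r h2 IH).
    have : 0 <= k%:R * th * th by rewrite !mulr_ge0// ltW.
    by lra.
  exact: bern.
rewrite -{1}(subnKC Nn) exprD ler_pM ?exprn_ge0//; try lra.
  by rewrite lerXn2r ?nnegrE ?lerD2l ?ge_min ?lexx//; lra.
by rewrite lerXn2r ?nnegrE ?lerD2l ?ge_min ?lexx ?orbT//; lra.
Qed.

Section MainEstimate.
Context {R : realType} (a b : nat -> R) (c C : R) (EL ER : \bar R).
Hypothesis c_gt0 : 0 < c.
Hypothesis a_bound : forall n, (1 <= n)%N -> c <= a n <= C.
Hypothesis b_bound : forall n, (1 <= n)%N -> - C <= b n <= C.
Hypothesis EL_lt_ER : (EL < ER)%E.
Notation p := (opoly a b).
Notation mu := (@lebesgue_measure R).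
Notation M := (supa a).
Notation bound := (bound_term a b EL ER).

Let a_gt0 n : (1 <= n)%N -> 0 < a n.
Proof. by move=> /a_bound/andP[h _]; exact: lt_le_trans h. Qed.

Lemma le_supa n : (1 <= n)%N -> a n <= M.
Proof.
move=> n1; apply: ub_le_sup; last by exists n.
by exists C => _ [j /= j1 <-]; have /andP[] := a_bound j1.
Qed.

Lemma supa_ge0 : 0 <= M.
Proof. by apply: le_trans (le_supa (leqnn 1)); exact/ltW/a_gt0. Qed.

Lemma geom_mean_gt0 n : 0 < geom_mean a n.
Proof.
by rewrite powR_gt0// big_nat prodr_gt0// => j /andP[j1 _]; exact: a_gt0.
Qed.

Lemma geom_meanX n : (1 <= n)%N -> geom_mean a n ^+ n = \prod_(1 <= j < n.+1) a j.
Proof.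
move=> n1; rewrite -powR_mulrn ?powR_ge0// -powRrM mulVf ?pnatr_eq0 -?lt0n//.
by rewrite powRr1// big_nat prodr_ge0// => j /andP[j1 _]; exact/ltW/a_gt0.
Qed.

Definition in_window n (x : R) : bool :=
  (EL - (2 * M)%:E - (geom_mean a n)%:E < x%:E < ER + (2 * M)%:E + (geom_mean a n)%:E)%E.

Lemma notin_I j n : (1 <= j < n.+1)%N -> (j \notin I_ a b EL ER n) = ~~ in_window n (b j).
Proof.
move=> jn; rewrite /I_ !inE/= mem_index_iota jn//.
Qed.

Lemma card_I n : #|` I_ a b EL ER n| = count (in_window n) [seq b i | i <- iota 1 n].
Proof.
rewrite card_imfset//= count_map -size_filter /index_iota subSS subn0.
by rewrite undup_id ?iota_uniq//; congr size; apply: eq_filter => j.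
Qed.

Lemma D_E n : D_ a b EL ER n =
  \prod_(1 <= j < n.+1 | ~~ in_window n (b j)) (edge_dist EL ER (b j) - 2 * M).
Proof.
rewrite /D_ big_nat_cond [RHS]big_nat_cond; apply: eq_bigl => j.
by case: (boolP (1 <= j < n.+1)%N) => //= jn; rewrite notin_I.
Qed.

Let outside n j (jn : ~~ in_window n (b j)) :=
  @edge_dist_outside R EL ER (b j) (2 * M) (geom_mean a n) EL_lt_ER
    (mulr_ge0 (ler0n R 2) supa_ge0) (ltW (geom_mean_gt0 n)) jn.

Lemma D_gt0 n : 0 < D_ a b EL ER n.
Proof.
rewrite D_E prodr_gt0// => j /outside[h _ _].
exact: lt_le_trans (geom_mean_gt0 n) h.
Qed.

Lemma bound_term_ge0 n : 0 <= bound n.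
Proof. by rewrite /bound_term; case: ifP => // _; exact: powR_ge0. Qed.

Lemma count_notin n : count (fun j => ~~ in_window n (b j)) (iota 1 n) =
  (n - #|` I_ a b EL ER n|)%N.
Proof.
rewrite card_I count_map; have := count_predC (in_window n \o b) (iota 1 n).
by rewrite size_iota => h; rewrite -[LHS](addKn (count (in_window n \o b) (iota 1 n))) h.
Qed.

Lemma card_I_le n : (#|` I_ a b EL ER n| <= n)%N.
Proof. by rewrite card_I (leq_trans (count_size _ _))// size_map size_iota. Qed.

(** With [N = #I_n], Weyl's pairing gives [D_n (1 + kap)^(n-N) |Q| <= A_n^n K]. For large [n] the
    growth lemma absorbs [K], leaving [|Q| <= (A_n^n / D_n) (1 + eps)^N], and the [N]-th root in
    Polya's inequality produces the factor [1 + eps]. *)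
Lemma opoly_small_measure (d K eps : R) : 0 < d -> 0 < K -> 0 < eps ->
  exists n0, forall n, (n0 <= n)%N -> (1 <= n)%N ->
    (mu (inner_window EL ER d `&` [set E | (`|(p n.+1).[E]| <= K)%R]) <=
      (4 * (bound n * (1 + eps)))%:E)%E.
Proof.
(* [dm] bounds every factor of [D_n], so adding [d] to a factor multiplies it by at least
   [1 + d / dm]. *)
move=> d0 K0 e0; pose dm := `|fine EL| + `|fine ER| + C.
have C0 : 0 < C.
  by have /andP[h1 h2] := a_bound (leqnn 1); exact: lt_le_trans c_gt0 (le_trans h1 h2).
have dm0 : 0 < dm by rewrite ltr_wpDl// addr_ge0.
pose kap := d / dm; have k0 : 0 < kap by rewrite divr_gt0.
have [n0 hn0] := two_rate_growth K e0 k0.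
exists n0 => n nn0 n1; set S := _ `&` _; set N := #|` I_ a b EL ER n|.
set A := geom_mean a n ^+ n; set D := D_ a b EL ER n.
have A0 : 0 < A by rewrite exprn_gt0// geom_mean_gt0.
have Dp : 0 < D by exact: D_gt0.
have root j : (p n.+1).[gauss_node a b (n := n) j] = 0.
  exact: gauss_node_root c_gt0 a_bound _ _ _.
have a_neq0 i : (1 <= i)%N -> a i != 0 by move=> ?; rewrite gt_eqF// a_gt0.
have a_ge0 i : (1 <= i)%N -> 0 <= a i by move=> ?; exact/ltW/a_gt0.
have [q sq hq] := weyl_product a_neq0 n1 (gauss_node_inj c_gt0 a_bound n1) root
  a_ge0 le_supa (in_window n).
rewrite -card_I -/N in sq.
pose Dd := \prod_(1 <= j < n.+1 | ~~ in_window n (b j)) (edge_dist EL ER (b j) - 2 * M + d).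
have DDd : D * (1 + kap) ^+ (n - N) <= Dd.
  have -> : (1 + kap) ^+ (n - N) = \prod_(i <- iota 1 n | ~~ in_window n (b i)) (1 + kap).
    by rewrite big_const_seq iter_mulr_1 count_notin.
  rewrite /D D_E /Dd /index_iota subSS subn0.
  rewrite -big_split/= big_seq_cond [leRHS]big_seq_cond; apply: ler_prod => j /andP[].
  rewrite mem_iota => /andP[j1 _] jw; have [h1 h2 _] := outside jw.
  have e1 : 0 < edge_dist EL ER (b j) - 2 * M by exact: lt_le_trans (geom_mean_gt0 n) h1.
  rewrite mulr_ge0 ?(ltW e1)//=; last by rewrite addr_ge0// ltW.
  rewrite mulrDr mulr1 lerD2l /kap mulrCA ler_piMr ?(ltW d0)//.
  rewrite ler_pdivrMr// mul1r (le_trans _ (le_trans h2 _))//.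
    by rewrite gerBl mulr_ge0// supa_ge0.
  by rewrite lerD2l ler_norml b_bound.
have SE E : S E -> Dd * \prod_(y <- q) `|E - y| <= A * K.
  move=> [[EL1 ER1] EK].
  have := hq E (fun x => edge_dist EL ER x - 2 * M + d).
  rewrite (opoly_horner b c_gt0 a_bound E n1) -(geom_meanX n1) -/A => h.
  have e1 x : ~~ in_window n x -> geom_mean a n <= edge_dist EL ER x - 2 * M /\
      (forall d E y : R, (EL + d%:E <= E%:E)%E -> (E%:E + d%:E <= ER)%E ->
        `|y - x| <= 2 * M -> edge_dist EL ER x - 2 * M + d <= `|E - y|).
    move=> xw.
    have [||? _ ?] := @edge_dist_outside R EL ER x (2 * M) (geom_mean a n) EL_lt_ER _ _ xw.
    - by rewrite mulr_ge0// supa_ge0.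
    - exact/ltW/geom_mean_gt0.
    by split.
  apply: (le_trans (h _ _)).
  - move=> x /e1[h1 _]; rewrite addr_ge0 ?(ltW d0)// (le_trans _ h1)//.
    exact/ltW/geom_mean_gt0.
  - by move=> x y /e1[_ h1] xy; exact: h1.
  - by rewrite ler_wpM2l// ltW.
have KN := hn0 n N nn0 (card_I_le n).
(* When [I_n] is empty, all [n] factors of [D_n] are at least [A_n], so [D_n >= A_n^n]; then [SE]
   contradicts the choice of [n0], and [S] is empty, in accordance with the value 0 of the bound. *)
rewrite /bound_term -/N -/A -/D; case: ifPn => [/eqP N0|N0].
  suff -> : S = set0 by rewrite measure0 mul0r mulr0.
  apply/seteqP; split => // E /SE.
  have -> : q = [::] by apply: size0nil; rewrite sq.
  rewrite big_nil mulr1; apply/negP; rewrite -ltNge.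
  apply: lt_le_trans DDd; move: KN; rewrite N0 expr0 mul1r subn0 => KN.
  apply: (@lt_le_trans _ _ (A * (1 + kap) ^+ n)); first by rewrite ltr_pM2l.
  rewrite ler_wpM2r ?exprn_ge0 ?addr_ge0 ?(ltW k0)//.
  have cn : count (fun j => ~~ in_window n (b j)) (iota 1 n) = n.
    by rewrite count_notin -/N N0 subn0.
  have -> : A = \prod_(j <- iota 1 n | ~~ in_window n (b j)) geom_mean a n.
    by rewrite big_const_seq iter_mulr_1 cn.
  rewrite /D D_E /index_iota subSS subn0; apply: ler_prod => j /outside[h1 _ _].
  by rewrite h1 ltW// geom_mean_gt0.
pose eta := A / D * (1 + eps) ^+ N.
have eta0 : 0 < eta by rewrite mulr_gt0 ?divr_gt0// exprn_gt0// addr_gt0.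
have q0 : (0 < size q)%N by rewrite sq lt0n.
apply: (@le_trans _ _ (mu [set E : R | (\prod_(y <- q) `|E - y| <= eta)%R])).
  apply: le_outer_measure => E /SE /= h.
  have Dd0 : 0 < D * (1 + kap) ^+ (n - N).
    by rewrite mulr_gt0// exprn_gt0// addr_gt0.
  rewrite -(ler_pM2l Dd0); apply: le_trans (le_trans h _).
    by rewrite ler_wpM2r// prodr_ge0.
  have -> : D * (1 + kap) ^+ (n - N) * eta = A * ((1 + eps) ^+ N * (1 + kap) ^+ (n - N)).
    have cancel (x y z w : R) : w != 0 -> w * x * (y / w * z) = y * (z * x).
      by move=> w0; field.
    by rewrite /eta cancel// gt_eqF.
  by rewrite ler_wpM2l ?(ltW A0)// ltW.
apply: le_trans (polya_ineq q0 eta0) _; rewrite lee_fin ler_pM2l// sq.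
(* The factor 1/2 inside Polya's bound is discarded. *)
apply: (@le_trans _ _ (eta `^ N%:R^-1)).
  apply: ge0_ler_powR => //; rewrite ?nnegrE.
  - by rewrite divr_ge0// ltW.
  - exact: ltW.
  - by rewrite ler_pdivrMr// ler_peMr ?(ltW eta0)// ler1n.
rewrite /eta powRM; last 2 first.
- by rewrite divr_ge0 ?ltW.
- by rewrite exprn_ge0// addr_ge0// ltW.
rewrite -powR_mulrn ?addr_ge0 ?(ltW e0)// -powRrM mulfV ?pnatr_eq0//.
by rewrite powRr1// addr_ge0// ltW.
Qed.

End MainEstimate.

Theorem theorem1p1 (R : realType) (a b : nat -> R) (c C : R) (EL ER : \bar R)
  (c_gt0 : 0 < c) (c_lt_C : c < C)
  (a_bound : forall n : nat, (1 <= n)%N -> c <= a n <= C)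
  (b_bound : forall n : nat, (1 <= n)%N -> - C <= b n <= C)
  (EL_lt_ER : (EL < ER)%E) :
  (lebesgue_measure (Sigma_ac a b `&` [set E : R | EL < E%:E < ER])
    <= 4%:E * limn_einf (fun n => (bound_term a b EL ER n)%:E))%E.
Proof.
set L := limn_einf _; set S := _ `&` _.
have b0 n : 0 <= bound_term a b EL ER n by exact: bound_term_ge0.
(* [L] is the supremum of the tail infima, so every tail has a term below any [s > L]. *)
have freq s n0 : (L < s%:E)%E -> exists2 n, (n0 <= n)%N & bound_term a b EL ER n < s.
  move=> Ls; pose u n := (bound_term a b EL ER n)%:E.
  have h : (einfs u n0 <= L)%E.
    rewrite /L limn_einf_lim (cvg_lim _ (@cvg_einfs_sup _ u))//.
    by apply: ereal_sup_ubound; exists n0.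
  have /ereal_inf_lt[_ [n /= nn0 <-]] := le_lt_trans h Ls.
  by rewrite lte_fin => ?; exists n.
have L0 : (0 <= L)%E.
  rewrite leNgt; apply/negP => /(freq 0 0%N)[n _].
  by rewrite ltNge b0.
(* All three constraints relax as [k] grows, so these measurable sets increase, and their union
   covers [S]. *)
pose X k : set R := ac_level a b k `&` `[(- k.+1%:R)%R, k.+1%:R]
  `&` inner_window EL ER k.+1%:R^-1.
have SX : S `<=` \bigcup_k X k.
  move=> E [/(Sigma_ac_sub_level c_gt0 a_bound)[k1 _ hk1] /inner_window_cover[d d0 hd]].
  pose k2 := Num.truncn `|E|; pose k3 := Num.truncn d^-1.
  exists (k1 + k2 + k3)%N => //; split; [split|].
  - have k1_le : (k1 <= k1 + k2 + k3)%N by rewrite -addnA leq_addr.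
    by have /subsetPset := ac_level_mono a b k1_le; apply.
  - rewrite /= in_itv/= -ler_norml (le_trans (ltW (truncnS_gt _)))// ler_nat ltnS.
    by rewrite -/k2 addnAC leq_addl.
  - apply: inner_window_mono hd; rewrite invf_ple ?posrE//.
    by rewrite (le_trans (ltW (truncnS_gt _)))// ler_nat ltnS leq_addl.
have mX k : measurable (X k).
  apply: measurableI; last exact: inner_window_measurable.
  by apply: measurableI => //; exact: ac_level_measurable.
have ndX : nondecreasing_seq X.
  move=> k k' kk'; apply/subsetPset => E [[h1 h2] h3]; split; [split|].
  - by have /subsetPset := ac_level_mono a b kk'; apply.
  - move: h2; rewrite /= !in_itv/= -!ler_norml => /le_trans; apply.
    by rewrite ler_nat.
  - by apply: inner_window_mono h3; rewrite lef_pV2 ?posrE// ler_nat.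
have main s : (L < s%:E)%E -> (lebesgue_measure S <= (4 * s)%:E)%E.
  move=> Ls; have s0 : 0 < s by rewrite -lte_fin (le_lt_trans L0).
  (* On [S] itself this is monotonicity of the outer measure. *)
  apply: (@le_trans _ _ (lebesgue_measure (\bigcup_k X k))); first exact: le_outer_measure.
  apply: bigcup_measure_le => // k; apply/lee_addgt0Pr => t t0.
  (* [K] leaves measure at most [t / 2] to the points where [|p_(n+1)| >= K]; [eps] below is chosen
     so that [4 * s * eps] is the other [t / 2]. *)
  pose K := Num.sqrt (4 * pi * k.+1%:R / (t / 2)).
  have pos : 0 < 4 * pi * k.+1%:R / (t / 2) by rewrite !divr_gt0 ?mulr_gt0 ?pi_gt0.
  have K0 : 0 < K by rewrite sqrtr_gt0.
  have K2 : K ^+ 2 = 4 * pi * k.+1%:R / (t / 2) by rewrite sqr_sqrtr// ltW.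
  pose eps := t / (8 * s); have e0 : 0 < eps by rewrite divr_gt0// mulr_gt0.
  have d0 : 0 < (k.+1%:R : R)^-1 by rewrite invr_gt0.
  have [n0 hn0] := opoly_small_measure c_gt0 a_bound b_bound EL_lt_ER d0 K0 e0.
  have [n nn0 ns] := freq s (maxn 1 n0) Ls.
  move: nn0; rewrite geq_max => /andP[n1 nn0].
  have T0 : 0 < k.+1%:R :> R by rewrite ltr0n.
  have m1 := ac_level_opoly_large c_gt0 a_bound b_bound k (isT : (1 <= n.+1)%N) T0 K0.
  have m2 := hn0 n nn0 n1.
  set Z1 := (X in lebesgue_measure X) in m1; set Z2 := (X in lebesgue_measure X) in m2.
  apply: (@le_trans _ _ (lebesgue_measure (Z1 `|` Z2))).
    apply: le_outer_measure => E [h1 h2].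
    have [hK|hK] := leP K `|(opoly a b n.+1).[E]|; [left|right]; split => //.
    exact: ltW.
  apply: (le_trans (outer_measureU2 _ _ _)).
  apply: (le_trans (leeD m1 m2)); rewrite -!EFinD lee_fin K2.
  have -> : 4 * pi * k.+1%:R / (4 * pi * k.+1%:R / (t / 2)) = t / 2.
    by rewrite invf_div mulrCA divff ?mulr1// !mulf_neq0 ?pnatr_eq0// gt_eqF// pi_gt0.
  have : bound_term a b EL ER n * (1 + eps) <= s * (1 + eps).
    by rewrite ler_wpM2r ?(ltW ns)// addr_ge0// ltW.
  have : s * (1 + eps) = s + t / 8 by rewrite /eps; field; rewrite gt_eqF.
  lra.
case: (L) L0 main => [r r0 main|_ _|//]; last by rewrite gt0_muley ?lte_fin// leey.
rewrite -EFinM; apply/lee_addgt0Pr => t t0.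
apply: le_trans (main (r + t / 4) _) _; first by rewrite lte_fin; lra.
by rewrite -EFinD lee_fin; lra.
Qed.
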